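(* Let $\mathcal A$ be a projective regular multiplier Hopf algebroid with a base weight $\mu$. Then every full left integral and every full right integral on $\mathcal A$ adapted to $\mu$ is faithful.
   Context: Conventions. Algebras are over $\mathbb C$ and need not be unital; products $XY$ of subspaces denote linear spans. An algebra $A$ is non-degenerate if $aA\neq 0\neq Aa$ for $a\ne 0$; $M(A)$ is its multiplier algebra. $A^\vee$ is the dual vector space. A functional $\omega$ on $D$ is faithful if $\omega(dD)\ne0\ne\omega(Dd)$ for all $d\neq 0$. Regular multiplier Hopf algebroids. Compatible left and right quantum graphs consist of a non-degenerate algebra $A$, commuting subalgebras $B,C\subseteq M(A)$ and anti-isomorphisms $S_B:B\to C$, $S_C:C\to B$ with $BA=AB=CA=AC=A$, such that (i) either every finite $F\subseteq A$ admits $e\in A$ with $ae=a$ for $a\in F$, or the left modules ${}_BA,{}_CA$ are flat; (ii) either every finite $F\subseteq A$ admits $e\in A$ with $ea=a$ for $a\in F$, or the right modules $A_B,A_C$ are flat. Quotients of $A\otimes A$ are defined by the relations (for $x\in B$, $y\in C$): $A\otimes_BA$: $ax\otimes b=a\otimes xb$; $A\otimes_CA$: $ay\otimes b=a\otimes yb$; $A\otimes^BA$: $xa\otimes b=a\otimes bx$; $A\otimes^CA$: $ya\otimes b=a\otimes by$; $A\otimes_lA$: $xa\otimes b=a\otimes S_B(x)b$; $A\otimes_rA$: $aS_C(y)\otimes b=a\otimes by$. A left comultiplication is a homomorphism $\Delta_B:A\to\mathrm{End}(A\otimes_lA)$ such that for each $a$ there are elements $\Delta_B(a)(1\otimes b)$,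 $\Delta_B(a)(b\otimes1)$ of $A\otimes_lA$ with $\Delta_B(a)(b\otimes c)=(\Delta_B(a)(1\otimes c))(b\otimes1)=(\Delta_B(a)(b\otimes1))(1\otimes c)$, and $\Delta_B(xyax'y')=(y\otimes x)\Delta_B(a)(y'\otimes x')$ for $x,x'\in B$, $y,y'\in C$, and $((\Delta_B\otimes\mathrm{id})(\Delta_B(b)(1\otimes c)))(a\otimes1\otimes1)=((\mathrm{id}\otimes\Delta_B)(\Delta_B(b)(a\otimes1)))(1\otimes1\otimes c)$. A right comultiplication is a homomorphism $\Delta_C:A\to\mathrm{End}(A\otimes_rA)^{op}$ (acting from the right) such that there are elements $(a\otimes1)\Delta_C(c),(1\otimes b)\Delta_C(c)\in A\otimes_rA$ with $(a\otimes b)\Delta_C(c)=(1\otimes b)((a\otimes1)\Delta_C(c))=(a\otimes1)((1\otimes b)\Delta_C(c))$, and $\Delta_C(xyax'y')=(y\otimes x)\Delta_C(a)(y'\otimes x')$, $(a\otimes1\otimes1)((\Delta_C\otimes\mathrm{id})((1\otimes c)\Delta_C(b)))=(1\otimes1\otimes c)((\mathrm{id}\otimes\Delta_C)((a\otimes1)\Delta_C(b)))$. These data form a multiplier bialgebroid $\mathcal A$ if also $((\Delta_B\otimes\mathrm{id})((1\otimes c)\Delta_C(b)))(a\otimes1\otimes1)=(1\otimes1\otimes c)((\mathrm{id}\otimes\Delta_C)(\Delta_B(b)(a\otimes1)))$ and $(a\otimes1\otimes1)((\Delta_C\otimes\mathrm{id})(\Delta_B(b)(1\otimes c)))=((\mathrm{id}\otimes\Delta_B)((a\otimes1)\Delta_C(b)))(1\otimes1\otimes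 c)$. It is a regular multiplier Hopf algebroid if the canonical maps $T_\lambda:A\otimes^CA\to A\otimes_lA$, $a\otimes b\mapsto\Delta_B(b)(a\otimes1)$; $T_\rho:A\otimes_BA\to A\otimes_lA$, $a\otimes b\mapsto\Delta_B(a)(1\otimes b)$; ${}_\lambda T:A\otimes_CA\to A\otimes_rA$, $a\otimes b\mapsto(a\otimes1)\Delta_C(b)$; ${}_\rho T:A\otimes^BA\to A\otimes_rA$, $a\otimes b\mapsto(1\otimes b)\Delta_C(a)$ are bijective. It is projective if the modules ${}_BA,A_B,{}_CA,A_C$ are all projective. Sweedler notation: $\Delta_B(a)(1\otimes b)=\sum a_{(1)}\otimes a_{(2)}b$, $\Delta_B(b)(a\otimes 1)=\sum b_{(1)}a\otimes b_{(2)}$, $(a\otimes1)\Delta_C(b)=\sum ab_{(1)}\otimes b_{(2)}$, $(1\otimes b)\Delta_C(a)=\sum a_{(1)}\otimes ba_{(2)}$. There are then a unique left counit ${}_B\varepsilon:A\to B$ and right counit $\varepsilon_C:A\to C$ with ${}_B\varepsilon(xa)=x\,{}_B\varepsilon(a)$, ${}_B\varepsilon(S_B(x)a)={}_B\varepsilon(a)x$, $\sum S_B({}_B\varepsilon(a_{(1)}))a_{(2)}b=ab$, $\sum{}_B\varepsilon(b_{(2)})b_{(1)}a=ba$, ${}_B\varepsilon(ab)={}_B\varepsilon(a\,{}_B\varepsilon(b))={}_B\varepsilon(aS_B({}_B\varepsilon(b)))$, and $\varepsilon_C(ay)=\varepsilon_C(a)y$, $\varepsilon_C(aS_C(y))=y\varepsilon_C(a)$,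 $\sum ba_{(2)}\varepsilon_C(a_{(1)})=ba$, $\sum ab_{(1)}S_C(\varepsilon_C(b_{(2)}))=ab$, $\varepsilon_C(ab)=\varepsilon_C(\varepsilon_C(a)b)=\varepsilon_C(S_C(\varepsilon_C(a))b)$. Base weights and integrals. A base weight is a pair $\mu=(\mu_B,\mu_C)$ of faithful functionals on $B$ and $C$ with $\mu_B\circ S_C=\mu_C$, $\mu_C\circ S_B=\mu_B$, $\mu_B\circ{}_B\varepsilon=\mu_C\circ\varepsilon_C$. A functional $\omega\in A^\vee$ is adapted to $\mu$ if there are (necessarily unique) maps ${}_B\omega,\omega_B:A\to B$, ${}_C\omega,\omega_C:A\to C$ with $\omega(xa)=\mu_B(x\,{}_B\omega(a))$, $\omega(ax)=\mu_B(\omega_B(a)x)$, $\omega(ya)=\mu_C(y\,{}_C\omega(a))$, $\omega(ay)=\mu_C(\omega_C(a)y)$ for all $x\in B,y\in C,a\in A$. A left integral is an adapted $\phi$ with $\sum S_B^{-1}({}_C\phi(b_{(2)}))b_{(1)}a={}_C\phi(b)a$ for all $a,b$, equivalently $\sum ab_{(1)}S_C(\phi_C(b_{(2)}))=a\phi_C(b)$ for all $a,b$ (then ${}_C\phi=\phi_C$). A right integral is an adapted $\psi$ with $\sum S_B({}_B\psi(a_{(1)}))a_{(2)}b={}_B\psi(a)b$ for all $a,b$, equivalently $\sum ba_{(2)}S_C^{-1}(\psi_B(a_{(1)}))=b\psi_B(a)$ for all $a,b$ (then ${}_B\psi=\psi_B$). A left integral $\phi$ is full if ${}_B\phi,\phi_B:A\to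 B$ are surjective; a right integral $\psi$ is full if ${}_C\psi,\psi_C:A\to C$ are surjective. *)

(* Defs.v *)
From HB Require Import structures.
From mathcomp Require Import all_boot all_order all_algebra.
From mathcomp Require Import ring_quotient.
From mathcomp Require Import boolp classical_sets reals.
From mathcomp Require Import finmap xfinmap monalg complex.

Set Implicit Arguments.
Unset Strict Implicit.
Unset Printing Implicit Defensive.

Import GRing.Theory.
Local Open Scope ring_scope.
Local Open Scope quotient_scope.

#[local] Obligation Tactic := idtac.

Definition is_bilinear (K : fieldType) (U V W : lmodType K)
    (f : U -> V -> W) : Prop :=
  (forall v, linear (f^~ v)) /\ (forall u, linear (f u)).

(** * Algebras without unit *)

HB.mixin Record isNonUnitalAlgebra (K : fieldType) A of GRing.Lmodule K A := {
  nmul : A -> A -> A;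
  nmulA : forall a b c, nmul a (nmul b c) = nmul (nmul a b) c;
  nmul_bilinear : is_bilinear nmul
}.

#[short(type="nuAlgType")]
HB.structure Definition NonUnitalAlgebra (K : fieldType) :=
  {A of isNonUnitalAlgebra K A & GRing.Lmodule K A}.

Notation "a ** b" := (nmul a b)
  (at level 40, left associativity) : ring_scope.

Definition nondegenerate (K : fieldType) (A : nuAlgType K) : Prop :=
  forall a : A, a != 0 ->
    (exists b, a ** b != 0) /\ (exists b, b ** a != 0).

Definition faithful (K : fieldType) (D : nuAlgType K)
    (w : {scalar D}) : Prop :=
  forall d : D, d != 0 ->
    (exists d', w (d ** d') != 0) /\ (exists d', w (d' ** d) != 0).

(** * The multiplier algebra *)

Section Multipliers.
Context (K : fieldType) (A : nuAlgType K).

(** A multiplier T is the pair of maps a |-> T a and a |-> a T. *)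
Record multiplier := Multiplier {
  mulL : A -> A;
  mulR : A -> A;
  mulL_linear : linear mulL;
  mulR_linear : linear mulR;
  mulLM : forall a b, mulL (a ** b) = mulL a ** b;
  mulRM : forall a b, mulR (a ** b) = a ** mulR b;
  mulRL : forall a b, mulR a ** b = a ** mulL b
}.

Lemma multiplierP (s t : multiplier) :
  mulL s =1 mulL t -> mulR s =1 mulR t -> s = t.
Proof.
case: s t => [L R h1 h2 h3 h4 h5] [L' R' h1' h2' h3' h4' h5'] /=.
move=> /funext eL /funext eR; subst L' R'.
by congr Multiplier; apply: Prop_irrelevance.
Qed.

HB.instance Definition _ := gen_eqMixin multiplier.
HB.instance Definition _ := gen_choiceMixin multiplier.

Lemma nmulZDl c (a b d : A) : (c *: a + b) ** d = c *: (a ** d) + b ** d.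
Proof. exact: (nmul_bilinear.1 d c a b). Qed.
Lemma nmulZDr c (a b d : A) : d ** (c *: a + b) = c *: (d ** a) + d ** b.
Proof. exact: (nmul_bilinear.2 d c a b). Qed.
Lemma nmulDl (a b d : A) : (a + b) ** d = a ** d + b ** d.
Proof. by rewrite -[a]scale1r nmulZDl !scale1r. Qed.
Lemma nmulDr (a b d : A) : d ** (a + b) = d ** a + d ** b.
Proof. by rewrite -[a]scale1r nmulZDr !scale1r. Qed.
Lemma nmul0l (d : A) : 0 ** d = 0.
Proof. by apply: (addrI (0 ** d)); rewrite -nmulDl !addr0. Qed.
Lemma nmul0r (d : A) : d ** 0 = 0.
Proof. by apply: (addrI (d ** 0)); rewrite -nmulDr !addr0. Qed.
Lemma nmulZl c (a d : A) : (c *: a) ** d = c *: (a ** d).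
Proof. by rewrite -[c *: a]addr0 nmulZDl nmul0l addr0. Qed.
Lemma nmulZr c (a d : A) : d ** (c *: a) = c *: (d ** a).
Proof. by rewrite -[c *: a]addr0 nmulZDr nmul0r addr0. Qed.

Program Definition mult0 := @Multiplier (fun=> 0) (fun=> 0) _ _ _ _ _.
Next Obligation. by move=> c a b; rewrite scaler0 addr0. Qed.
Next Obligation. by move=> c a b; rewrite scaler0 addr0. Qed.
Next Obligation. by move=> a b; rewrite nmul0l. Qed.
Next Obligation. by move=> a b; rewrite nmul0r. Qed.
Next Obligation. by move=> a b; rewrite nmul0l nmul0r. Qed.

(** [multZD c s t] is c s + t. *)
Program Definition multZD (c : K) (s t : multiplier) :=
  @Multiplier (fun a => c *: mulL s a + mulL t a)
              (fun a => c *: mulR s a + mulR t a) _ _ _ _ _.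
Next Obligation.
move=> c s t d a b; rewrite !mulL_linear !scalerDr !scalerA (mulrC c d).
exact: addrACA.
Qed.
Next Obligation.
move=> c s t d a b; rewrite !mulR_linear !scalerDr !scalerA (mulrC c d).
exact: addrACA.
Qed.
Next Obligation. by move=> c s t a b /=; rewrite !mulLM nmulZDl. Qed.
Next Obligation. by move=> c s t a b /=; rewrite !mulRM nmulZDr. Qed.
Next Obligation.
by move=> c s t a b /=; rewrite nmulZDl nmulZDr !mulRL.
Qed.

Definition multD := multZD 1.
Definition multN s := multZD (-1) s mult0.
Definition multZ c s := multZD c s mult0.

Fact multDA : associative multD.
Proof. by move=> s t u; apply: multiplierP => a /=; rewrite !scale1r addrA. Qed.
Fact multDC : commutative multD.
Proof.
by move=> s t; apply: multiplierP => a /=; rewrite !scale1r addrC.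
Qed.
Fact mult0D : left_id mult0 multD.
Proof. by move=> s; apply: multiplierP => a /=; rewrite scaler0 add0r. Qed.
Fact multND : left_inverse mult0 multN multD.
Proof.
by move=> s; apply: multiplierP => a /=; rewrite addr0 scale1r scaleN1r addNr.
Qed.

HB.instance Definition _ :=
  GRing.isZmodule.Build multiplier multDA multDC mult0D multND.

Fact multZA c d s : multZ c (multZ d s) = multZ (c * d) s.
Proof. by apply: multiplierP => a /=; rewrite !addr0 scalerA. Qed.
Fact mult1Z : left_id 1 multZ.
Proof. by move=> s; apply: multiplierP => a /=; rewrite addr0 scale1r. Qed.
Fact multZDr : right_distributive multZ +%R.
Proof.
by move=> c s t; apply: multiplierP => a /=;
   rewrite !addr0 !scale1r scalerDr.
Qed.
Fact multZDl s : {morph multZ^~ s : c d / c + d}.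
Proof.
by move=> c d; apply: multiplierP => a /=; rewrite !addr0 scale1r scalerDl.
Qed.

HB.instance Definition _ :=
  GRing.Zmodule_isLmodule.Build K multiplier multZA mult1Z multZDr multZDl.

Program Definition multM (s t : multiplier) :=
  @Multiplier (mulL s \o mulL t) (mulR t \o mulR s) _ _ _ _ _.
Next Obligation. by move=> s t c a b /=; rewrite !mulL_linear. Qed.
Next Obligation. by move=> s t c a b /=; rewrite !mulR_linear. Qed.
Next Obligation. by move=> s t a b /=; rewrite !mulLM. Qed.
Next Obligation. by move=> s t a b /=; rewrite !mulRM. Qed.
Next Obligation. by move=> s t a b /=; rewrite !mulRL. Qed.

Fact multMA s t u : multM s (multM t u) = multM (multM s t) u.
Proof. exact: multiplierP. Qed.
Lemma mulL_ZD c s t a : mulL (c *: s + t) a = c *: mulL s a + mulL t a.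
Proof. by rewrite /= scale1r addr0. Qed.
Lemma mulR_ZD c s t a : mulR (c *: s + t) a = c *: mulR s a + mulR t a.
Proof. by rewrite /= scale1r addr0. Qed.

Fact multM_bilinear : is_bilinear multM.
Proof.
split=> t c u v; apply: multiplierP => a.
- by rewrite mulL_ZD /= scale1r addr0.
- by rewrite mulR_ZD /= scale1r addr0 mulR_linear.
- by rewrite mulL_ZD /= scale1r addr0 mulL_linear.
- by rewrite mulR_ZD /= scale1r addr0.
Qed.

HB.instance Definition _ :=
  isNonUnitalAlgebra.Build K multiplier multMA multM_bilinear.

End Multipliers.

(** * Modules over algebras without unit *)

Section Modules.
Context (K : fieldType).

Definition left_module (B : nuAlgType K) (M : lmodType K)
    (act : B -> M -> M) : Prop :=
  is_bilinear act /\ forall x y m, act (x ** y) m = act x (act y m).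

(** For a right module, [act x m] stands for m x. *)
Definition right_module (B : nuAlgType K) (M : lmodType K)
    (act : B -> M -> M) : Prop :=
  is_bilinear act /\ forall x y m, act (x ** y) m = act y (act x m).

Definition equivariant (I : Type) (M N : lmodType K)
    (aM : I -> M -> M) (aN : I -> N -> N) (f : M -> N) : Prop :=
  forall i m, f (aM i m) = aN i (f m).

Definition surjective (S T : Type) (f : S -> T) : Prop :=
  forall t, exists s, f s = t.

(** The lifting property against all surjections of modules. B may lack a unit,
    so no unitality is imposed on modules; equivalently these are the unital
    modules over the unitization of B. *)
Definition projective_among (B : nuAlgType K)
    (is_module : forall M : lmodType K, (B -> M -> M) -> Prop)
    (P : lmodType K) (aP : B -> P -> P) : Prop :=
  forall (M N : lmodType K) (aM : B -> M -> M) (aN : B -> N -> N)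
         (g : {linear M -> N}) (f : {linear P -> N}),
    is_module M aM -> is_module N aN ->
    equivariant aM aN g -> equivariant aP aN f -> surjective g ->
    exists2 h : {linear P -> M}, equivariant aP aM h & g \o h =1 f.

Definition left_projective (B : nuAlgType K) (P : lmodType K)
    (aP : B -> P -> P) : Prop := projective_among (@left_module B) aP.

Definition right_projective (B : nuAlgType K) (P : lmodType K)
    (aP : B -> P -> P) : Prop := projective_among (@right_module B) aP.

End Modules.

(** * Vector spaces given by generators and relations *)

Section Presented.
Context (K : fieldType) (X : choiceType) (rel : {malg K[X]} -> Prop).

Inductive rel_span : {malg K[X]} -> Prop :=
| SpanRel v of rel v : rel_span v
| Span0 : rel_span 0
| SpanD v w of rel_span v & rel_span w : rel_span (v + w)
| SpanZ c v of rel_span v : rel_span (c *: v).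

Definition rel_span_pred : {pred {malg K[X]}} := fun v => `[< rel_span v >].

Fact rel_span_zmod_closed : zmod_closed rel_span_pred.
Proof.
split; first by apply/asboolP; exact: Span0.
move=> v w /asboolP hv /asboolP hw; apply/asboolP.
by rewrite -scaleN1r; apply: SpanD => //; apply: SpanZ.
Qed.

HB.instance Definition _ :=
  GRing.isZmodClosed.Build {malg K[X]} rel_span_pred rel_span_zmod_closed.

Definition presented := Quotient.quot rel_span_pred.

HB.instance Definition _ := GRing.Zmodule.on presented.

Definition presented_class (v : {malg K[X]}) : presented := \pi_presented v.

Definition presented_scale (c : K) (t : presented) : presented :=
  presented_class (c *: repr t).

Lemma presented_classP v w :
  presented_class v = presented_class w <-> rel_span (v - w).
Proof.
rewrite /presented_class; split.
  by move=> /eqP; rewrite -Quotient.idealrBE => /asboolP.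
by move=> h; apply/eqP; rewrite -Quotient.idealrBE; apply/asboolP.
Qed.

Lemma presented_classK t : presented_class (repr t) = t.
Proof. exact: reprK. Qed.

Lemma presented_classD v w :
  presented_class (v + w) = presented_class v + presented_class w.
Proof. exact: raddfD. Qed.

Lemma presented_classZ c v :
  presented_class (c *: v) = presented_scale c (presented_class v).
Proof.
apply/presented_classP; rewrite -scalerBr; apply: SpanZ.
by apply/presented_classP; rewrite presented_classK.
Qed.

Fact presented_scaleA c d t :
  presented_scale c (presented_scale d t) = presented_scale (c * d) t.
Proof.
by rewrite -[t]presented_classK -!presented_classZ scalerA.
Qed.
Fact presented_scale1 : left_id 1 presented_scale.
Proof.
by move=> t; rewrite -[t]presented_classK -presented_classZ scale1r.
Qed.
Fact presented_scaleDr : right_distributive presented_scale +%R.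
Proof.
move=> c s t; rewrite -[s]presented_classK -[t]presented_classK.
by rewrite -presented_classD -!presented_classZ scalerDr presented_classD.
Qed.
Fact presented_scaleDl t : {morph presented_scale^~ t : c d / c + d}.
Proof.
move=> c d; rewrite -[t]presented_classK -!presented_classZ scalerDl.
exact: presented_classD.
Qed.

HB.instance Definition _ :=
  GRing.Zmodule_isLmodule.Build K presented presented_scaleA presented_scale1
    presented_scaleDr presented_scaleDl.

Definition presented_gen (x : X) : presented := presented_class << x >>.

(** The linear extension of a map on generators; it is meaningful when that map
    respects the relations, see [pres_liftP]. *)
Definition free_lift (V : lmodType K) (f : X -> V) (v : {malg K[X]}) : V :=
  \sum_(x <- msupp v) v@_x *: f x.

Definition pres_lift (V : lmodType K) (f : X -> V) (t : presented) : V :=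
  free_lift f (repr t).

Section LiftTheory.
Context (V : lmodType K) (f : X -> V).

Lemma free_liftEw (d : {fset X}) v : (msupp v `<=` d)%fset ->
  free_lift f v = \sum_(x <- d) v@_x *: f x.
Proof.
move=> le; rewrite /free_lift; apply: big_fset_incl => // x xd.
by move=> /mcoeff_outdom ->; rewrite scale0r.
Qed.

Lemma free_lift_linear : linear (free_lift f).
Proof.
move=> c v w.
pose d := (msupp v `|` msupp w)%fset.
have dv : (msupp v `<=` d)%fset by apply: fsubsetUl.
have dw : (msupp w `<=` d)%fset by apply: fsubsetUr.
have dcvw : (msupp (c *: v + w) `<=` d)%fset.
  apply: (fsubset_trans (msuppD_le _ _)).
  by rewrite fsetSU // msuppZ_le.
rewrite (free_liftEw dcvw) (free_liftEw dv) (free_liftEw dw).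
rewrite scaler_sumr -big_split /=; apply: eq_bigr => x _.
by rewrite mcoeffD mcoeffZ scalerDl scalerA.
Qed.

Lemma free_lift_gen x : free_lift f << x >> = f x.
Proof.
by rewrite (free_liftEw (d := [fset x]%fset)) ?msuppU_le //
           big_seq_fset1 mcoeffUU scale1r.
Qed.

Context (f_rel : forall v, rel v -> free_lift f v = 0).

Lemma pres_lift_class v : pres_lift f (presented_class v) = free_lift f v.
Proof.
have H w : rel_span w -> free_lift f w = 0.
  elim=> {w} [w /f_rel //| |w w' _ e _ e'|c w _ e].
  - by rewrite /free_lift msupp0 big_seq_fset0.
  - by rewrite -[w]scale1r free_lift_linear e e' scaler0 addr0.
  - rewrite -[c *: w]addr0 free_lift_linear e scaler0 add0r.
    by rewrite /free_lift msupp0 big_seq_fset0.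
have /H : rel_span (repr (presented_class v) - v).
  by apply/presented_classP; rewrite presented_classK.
rewrite addrC -scaleN1r free_lift_linear scaleN1r => /eqP.
by rewrite addrC subr_eq0 => /eqP.
Qed.

Lemma pres_liftP :
  linear (pres_lift f) /\ forall x, pres_lift f (presented_gen x) = f x.
Proof.
split; last by move=> x; rewrite pres_lift_class free_lift_gen.
move=> c s t; rewrite -[s]presented_classK -[t]presented_classK.
have -> : c *: presented_class (repr s) + presented_class (repr t)
          = presented_class (c *: repr s + repr t).
  by rewrite presented_classD presented_classZ.
by rewrite !pres_lift_class free_lift_linear.
Qed.

End LiftTheory.

End Presented.

(** * Balanced tensor products *)

Section Tensor.
Context (K : fieldType) (M N : lmodType K) (I : Type).
Context (r : I -> M -> M) (l : I -> N -> N).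

Inductive tensor_rel : {malg K[(M * N)%type]} -> Prop :=
| TensorDl m m' n :
    tensor_rel (<< (m + m', n) >> - << (m, n) >> - << (m', n) >>)
| TensorDr m n n' :
    tensor_rel (<< (m, n + n') >> - << (m, n) >> - << (m, n') >>)
| TensorZl c m n : tensor_rel (<< (c *: m, n) >> - c *: << (m, n) >>)
| TensorZr c m n : tensor_rel (<< (m, c *: n) >> - c *: << (m, n) >>)
| TensorBal i m n : tensor_rel (<< (r i m, n) >> - << (m, l i n) >>).

(** The tensor product over K divided by (r i m) (x) n = m (x) (l i n). *)
Definition tensor := presented tensor_rel.
HB.instance Definition _ := GRing.Lmodule.on tensor.

Definition tens (m : M) (n : N) : tensor := presented_gen tensor_rel (m, n).

(** [tlift f] sends m (x) n to f m n if f is bilinear and balanced. *)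
Definition tlift (V : lmodType K) (f : M -> N -> V) (t : tensor) : V :=
  pres_lift (fun p => f p.1 p.2) t.

Lemma tliftP (V : lmodType K) (f : M -> N -> V) :
  is_bilinear f -> (forall i m n, f (r i m) n = f m (l i n)) ->
  linear (tlift f) /\ forall m n, tlift f (tens m n) = f m n.
Proof.
move=> [fl fr] fb.
pose g (p : M * N) := f p.1 p.2.
have L := free_lift_linear g.
have fB v w : free_lift g (v - w) = free_lift g v - free_lift g w.
  by rewrite addrC -(scaleN1r w) L scaleN1r addrC.
have fZ c v : free_lift g (c *: v) = c *: free_lift g v.
  by rewrite -[c *: v]addr0 L /free_lift msupp0 big_seq_fset0 addr0.
have f0l n : f 0 n = 0.
  have := fl n (-1) 0 0; rewrite scaler0 addr0 scaleN1r => ->.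
  by rewrite addNr.
have f0r m : f m 0 = 0.
  have := fr m (-1) 0 0; rewrite scaler0 addr0 scaleN1r => ->.
  by rewrite addNr.
have H v : tensor_rel v -> free_lift g v = 0.
  case=> *; rewrite !(fB, fZ, free_lift_gen) /g /=.
  - rewrite -[X in f (X + _)]scale1r fl scale1r -addrA -opprD.
    by rewrite subrr.
  - rewrite -[X in f _ (X + _)]scale1r fr scale1r -addrA -opprD.
    by rewrite subrr.
  - by rewrite -[X in f X]addr0 fl f0l addr0 subrr.
  - by rewrite -[X in f _ X]addr0 fr f0r addr0 subrr.
  - by rewrite fb subrr.
have [? E] := pres_liftP H; split=> // m n.
exact: E.
Qed.

End Tensor.

Arguments tens {K M N I r l} m n.
Arguments tlift {K M N I r l V} f t.

Definition tmap (K : fieldType) (M N M' N' : lmodType K) (I I' : Type)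
    (r : I -> M -> M) (l : I -> N -> N) (r' : I' -> M' -> M')
    (l' : I' -> N' -> N') (f : M -> M') (g : N -> N') :
    tensor r l -> tensor r' l' :=
  tlift (fun m n => tens (f m) (g n)).
Arguments tmap {K M N M' N' I I' r l r' l'} f g t.

Section Tensor3.
Context (K : fieldType) (M N P : lmodType K) (I J : Type).
Context (r : I -> M -> M) (l : I -> N -> N).
Context (r' : J -> N -> N) (l' : J -> P -> P).

Inductive tensor3_rel : {malg K[(M * N * P)%type]} -> Prop :=
| Tensor3D1 m m' n p : tensor3_rel
    (<< (m + m', n, p) >> - << (m, n, p) >> - << (m', n, p) >>)
| Tensor3D2 m n n' p : tensor3_rel
    (<< (m, n + n', p) >> - << (m, n, p) >> - << (m, n', p) >>)
| Tensor3D3 m n p p' : tensor3_rel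
    (<< (m, n, p + p') >> - << (m, n, p) >> - << (m, n, p') >>)
| Tensor3Z1 c m n p :
    tensor3_rel (<< (c *: m, n, p) >> - c *: << (m, n, p) >>)
| Tensor3Z2 c m n p :
    tensor3_rel (<< (m, c *: n, p) >> - c *: << (m, n, p) >>)
| Tensor3Z3 c m n p :
    tensor3_rel (<< (m, n, c *: p) >> - c *: << (m, n, p) >>)
| Tensor3Bal12 i m n p :
    tensor3_rel (<< (r i m, n, p) >> - << (m, l i n, p) >>)
| Tensor3Bal23 j m n p :
    tensor3_rel (<< (m, r' j n, p) >> - << (m, n, l' j p) >>).

(** The tensor product over K divided by
    (r i m) (x) n (x) p = m (x) (l i n) (x) p and
    m (x) (r' j n) (x) p = m (x) n (x) (l' j p). *)
Definition tensor3 := presented tensor3_rel.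
HB.instance Definition _ := GRing.Lmodule.on tensor3.

Definition tens3 (m : M) (n : N) (p : P) : tensor3 :=
  presented_gen tensor3_rel (m, n, p).

End Tensor3.

Arguments tens3 {K M N P I J r l r' l'} m n p.

Section Flatness.
Context (K : fieldType) (B : nuAlgType K).

Definition left_flat (P : lmodType K) (aP : B -> P -> P) : Prop :=
  forall (N N' : lmodType K) (aN : B -> N -> N) (aN' : B -> N' -> N')
         (f : {linear N -> N'}),
    right_module aN -> right_module aN' ->
    equivariant aN aN' f -> injective f ->
    injective (tmap f id : tensor aN aP -> tensor aN' aP).

Definition right_flat (P : lmodType K) (aP : B -> P -> P) : Prop :=
  forall (N N' : lmodType K) (aN : B -> N -> N) (aN' : B -> N' -> N')
         (f : {linear N -> N'}),
    left_module aN -> left_module aN' ->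
    equivariant aN aN' f -> injective f ->
    injective (tmap id f : tensor aP aN -> tensor aP aN').

End Flatness.

(** * Compatible left and right quantum graphs *)

(** The subalgebras B, C of M(A) are given by injective homomorphisms. *)
Record quantum_graphs (K : fieldType) := QuantumGraphs {
  tot : nuAlgType K;
  bB : nuAlgType K;
  bC : nuAlgType K;
  tot_nondegenerate : nondegenerate tot;
  iB : {linear bB -> multiplier tot};
  iC : {linear bC -> multiplier tot};
  iB_inj : injective iB;
  iC_inj : injective iC;
  iBM : forall x x', iB (x ** x') = iB x ** iB x';
  iCM : forall y y', iC (y ** y') = iC y ** iC y';
  iBC_comm : forall x y, iB x ** iC y = iC y ** iB x;
  SB : {linear bB -> bC};
  SC : {linear bC -> bB};
  SBinv : bC -> bB;
  SCinv : bB -> bC;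
  SBK : cancel SB SBinv;
  SBinvK : cancel SBinv SB;
  SCK : cancel SC SCinv;
  SCinvK : cancel SCinv SC;
  SB_antimul : forall x x', SB (x ** x') = SB x' ** SB x;
  SC_antimul : forall y y', SC (y ** y') = SC y' ** SC y;
  BA_full : forall a, exists s : seq (bB * tot),
    a = \sum_(p <- s) mulL (iB p.1) p.2;
  AB_full : forall a, exists s : seq (bB * tot),
    a = \sum_(p <- s) mulR (iB p.1) p.2;
  CA_full : forall a, exists s : seq (bC * tot),
    a = \sum_(p <- s) mulL (iC p.1) p.2;
  AC_full : forall a, exists s : seq (bC * tot),
    a = \sum_(p <- s) mulR (iC p.1) p.2;
  left_units_or_flat :
    (forall F : seq tot, exists e, forall a, a \in F -> a ** e = a) \/
    (left_flat (fun x a => mulL (iB x) a) /\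
     left_flat (fun y a => mulL (iC y) a));
  right_units_or_flat :
    (forall F : seq tot, exists e, forall a, a \in F -> e ** a = a) \/
    (right_flat (fun x a => mulR (iB x) a) /\
     right_flat (fun y a => mulR (iC y) a))
}.

Section GraphTensors.
Context (K : fieldType) (Q : quantum_graphs K).
Notation A := (tot Q).
Notation B := (bB Q).
Notation C := (bC Q).

(** x a, a x, y a and a y for x in B and y in C. *)
Definition lB (x : B) (a : A) : A := mulL (iB Q x) a.
Definition rB (x : B) (a : A) : A := mulR (iB Q x) a.
Definition lC (y : C) (a : A) : A := mulL (iC Q y) a.
Definition rC (y : C) (a : A) : A := mulR (iC Q y) a.

Definition tensor_subB := tensor rB lB.
Definition tensor_subC := tensor rC lC.
Definition tensor_supB := tensor lB rB.
Definition tensor_supC := tensor lC rC.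

Definition lSB (x : B) (a : A) : A := lC (SB Q x) a.
Definition rSC (y : C) (a : A) : A := rB (SC Q y) a.

Definition tensor_l := tensor lB lSB.
Definition tensor_r := tensor rSC rC.

Definition tensor_ll := tensor3 lB lSB lB lSB.
Definition tensor_rr := tensor3 rSC rC rSC rC.
Definition tensor_lr := tensor3 lB lSB rSC rC.
Definition tensor_rl := tensor3 rSC rC lB lSB.

HB.instance Definition _ := GRing.Lmodule.on tensor_l.
HB.instance Definition _ := GRing.Lmodule.on tensor_r.
HB.instance Definition _ := GRing.Lmodule.on tensor_ll.
HB.instance Definition _ := GRing.Lmodule.on tensor_rr.
HB.instance Definition _ := GRing.Lmodule.on tensor_lr.
HB.instance Definition _ := GRing.Lmodule.on tensor_rl.

End GraphTensors.

(** * Multiplier bialgebroids *)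

Record multiplier_bialgebroid (K : fieldType) := MultiplierBialgebroid {
  graphs :> quantum_graphs K;

  (** [DeltaB a] is the operator Delta_B(a), and [DeltaB1r a b], [DeltaB1l a b]
      are the elements Delta_B(a)(1 (x) b) and Delta_B(a)(b (x) 1). *)
  DeltaB : tot graphs -> {linear tensor_l graphs -> tensor_l graphs};
  DeltaB1r : tot graphs -> tot graphs -> tensor_l graphs;
  DeltaB1l : tot graphs -> tot graphs -> tensor_l graphs;
  DeltaB_linear : forall k a b t,
    DeltaB (k *: a + b) t = k *: DeltaB a t + DeltaB b t;
  DeltaB_mul : forall a b t, DeltaB (a ** b) t = DeltaB a (DeltaB b t);
  DeltaB1rP : forall a b c,
    DeltaB a (tens b c) = tmap (nmul^~ b) id (DeltaB1r a c);
  DeltaB1lP : forall a b c,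
    DeltaB a (tens b c) = tmap id (nmul^~ c) (DeltaB1l a b);
  DeltaB_base : forall x x' y y' a t,
    DeltaB (lB x (lC y (rB x' (rC y' a)))) t =
    tmap (lC y) (lB x) (DeltaB a (tmap (lC y') (lB x') t));
  DeltaB_coassoc : forall a b c,
    tlift (fun p q => tlift (fun u v => tens3 u v q) (DeltaB1l p a))
      (DeltaB1r b c) =
    tlift (fun p q => tlift (fun u v => tens3 p u v) (DeltaB1r q c))
      (DeltaB1l b a) :> tensor_ll graphs;

  (** [DeltaC a t] is t Delta_C(a), and [DeltaC1l a c], [DeltaC1r b c] are the
      elements (a (x) 1)Delta_C(c) and (1 (x) b)Delta_C(c). *)
  DeltaC : tot graphs -> {linear tensor_r graphs -> tensor_r graphs};
  DeltaC1l : tot graphs -> tot graphs -> tensor_r graphs;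
  DeltaC1r : tot graphs -> tot graphs -> tensor_r graphs;
  DeltaC_linear : forall k a b t,
    DeltaC (k *: a + b) t = k *: DeltaC a t + DeltaC b t;
  DeltaC_mul : forall a b t, DeltaC (a ** b) t = DeltaC b (DeltaC a t);
  DeltaC1lP : forall a b c,
    DeltaC c (tens a b) = tmap id (nmul b) (DeltaC1l a c);
  DeltaC1rP : forall a b c,
    DeltaC c (tens a b) = tmap (nmul a) id (DeltaC1r b c);
  DeltaC_base : forall x x' y y' a t,
    DeltaC (lB x (lC y (rB x' (rC y' a)))) t =
    tmap (rC y') (rB x') (DeltaC a (tmap (rC y) (rB x) t));
  DeltaC_coassoc : forall a b c,
    tlift (fun p q => tlift (fun u v => tens3 u v q) (DeltaC1l a p))
      (DeltaC1r c b) =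
    tlift (fun p q => tlift (fun u v => tens3 p u v) (DeltaC1r c q))
      (DeltaC1l a b) :> tensor_rr graphs;

  DeltaBC_coassoc : forall a b c,
    tlift (fun p q => tlift (fun u v => tens3 u v q) (DeltaB1l p a))
      (DeltaC1r c b) =
    tlift (fun p q => tlift (fun u v => tens3 p u v) (DeltaC1r c q))
      (DeltaB1l b a) :> tensor_lr graphs;
  DeltaCB_coassoc : forall a b c,
    tlift (fun p q => tlift (fun u v => tens3 u v q) (DeltaC1l a p))
      (DeltaB1r b c) =
    tlift (fun p q => tlift (fun u v => tens3 p u v) (DeltaB1r q c))
      (DeltaC1l a b) :> tensor_rl graphs
}.

Section CanonicalMaps.
Context (K : fieldType) (H : multiplier_bialgebroid K).

Definition T_lambda : tensor_supC H -> tensor_l H :=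
  tlift (fun a b => DeltaB1l b a).
Definition T_rho : tensor_subB H -> tensor_l H :=
  tlift (fun a b => DeltaB1r a b).
Definition lambda_T : tensor_subC H -> tensor_r H :=
  tlift (fun a b => DeltaC1l a b).
Definition rho_T : tensor_supB H -> tensor_r H :=
  tlift (fun a b => DeltaC1r b a).

End CanonicalMaps.

Record regular_multiplier_Hopf_algebroid (K : fieldType) :=
  RegularMultiplierHopfAlgebroid {
  bialgebroid :> multiplier_bialgebroid K;
  T_lambda_bij : bijective (@T_lambda K bialgebroid);
  T_rho_bij : bijective (@T_rho K bialgebroid);
  lambda_T_bij : bijective (@lambda_T K bialgebroid);
  rho_T_bij : bijective (@rho_T K bialgebroid)
}.

Section Integrals.
Context (K : fieldType) (H : regular_multiplier_Hopf_algebroid K).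
Notation A := (tot H).
Notation B := (bB H).
Notation C := (bC H).

Definition projective : Prop :=
  [/\ left_projective (@lB K H), right_projective (@rB K H),
      left_projective (@lC K H) & right_projective (@rC K H)].

Record left_counit (eps : {linear A -> B}) : Prop := {
  left_counit_lB : forall x a, eps (lB x a) = x ** eps a;
  left_counit_lSB : forall x a, eps (lSB x a) = eps a ** x;
  left_counit_id1 : forall a b,
    tlift (fun u v => lC (SB H (eps u)) v) (DeltaB1r a b) = a ** b;
  left_counit_id2 : forall a b,
    tlift (fun u v => lB (eps v) u) (DeltaB1l b a) = b ** a;
  left_counit_mul1 : forall a b, eps (a ** b) = eps (rB (eps b) a);
  left_counit_mul2 : forall a b, eps (a ** b) = eps (rC (SB H (eps b)) a)
}.

Record right_counit (eps : {linear A -> C}) : Prop := {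
  right_counit_rC : forall y a, eps (rC y a) = eps a ** y;
  right_counit_rSC : forall y a, eps (rSC y a) = y ** eps a;
  right_counit_id1 : forall a b,
    tlift (fun u v => rC (eps u) v) (DeltaC1r b a) = b ** a;
  right_counit_id2 : forall a b,
    tlift (fun u v => rB (SC H (eps v)) u) (DeltaC1l a b) = a ** b;
  right_counit_mul1 : forall a b, eps (a ** b) = eps (lC (eps a) b);
  right_counit_mul2 : forall a b, eps (a ** b) = eps (lB (SC H (eps a)) b)
}.

Record base_weight (epsB : {linear A -> B}) (epsC : {linear A -> C})
    (muB : {scalar B}) (muC : {scalar C}) : Prop := {
  muB_faithful : faithful muB;
  muC_faithful : faithful muC;
  muB_SC : forall y, muB (SC H y) = muC y;
  muC_SB : forall x, muC (SB H x) = muB x;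
  mu_counits : forall a, muB (epsB a) = muC (epsC a)
}.

Section Adapted.
Context (muB : {scalar B}) (muC : {scalar C}).

(** [Bw], [wB], [Cw], [wC] are the partial integrals of w, with the base algebra
    written on the side on which w is a module map. *)
Record adapted (w : {scalar A}) (Bw wB : A -> B) (Cw wC : A -> C) : Prop := {
  adapted_lB : forall x a, w (lB x a) = muB (x ** Bw a);
  adapted_rB : forall x a, w (rB x a) = muB (wB a ** x);
  adapted_lC : forall y a, w (lC y a) = muC (y ** Cw a);
  adapted_rC : forall y a, w (rC y a) = muC (wC a ** y)
}.

Definition left_invariant (Cphi : A -> C) : Prop :=
  forall a b, tlift (fun u v => lB (SBinv (Cphi v)) u) (DeltaB1l b a) =
              lC (Cphi b) a.

Definition right_invariant (Bpsi : A -> B) : Prop :=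
  forall a b, tlift (fun u v => lC (SB H (Bpsi u)) v) (DeltaB1r a b) =
              lB (Bpsi a) b.

(** As muB and muC are faithful, the maps below are unique. *)
Definition full_left_integral (phi : {scalar A}) : Prop :=
  exists (Bphi phiB : A -> B) (Cphi phiC : A -> C),
    [/\ adapted phi Bphi phiB Cphi phiC, left_invariant Cphi,
        surjective Bphi & surjective phiB].

Definition full_right_integral (psi : {scalar A}) : Prop :=
  exists (Bpsi psiB : A -> B) (Cpsi psiC : A -> C),
    [/\ adapted psi Bpsi psiB Cpsi psiC, right_invariant Bpsi,
        surjective Cpsi & surjective psiC].

End Adapted.

End Integrals.

(* Main.v *)
(** Write N = {a : phi(A a) = 0} for a left integral phi, R_d(a) for the slice
    sum a1 S_C(phi_C(d a2)) of Delta_C(a), and L_q(r) for the slice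
    sum S_B^-1(phi_C(r2 q)) r1 of Delta_B(r). No antipode is needed; everything
    follows from the bijectivity of the canonical maps.

    1. mu_B(eps_B(R_d(a)) x) = phi(d S_B(x) a), so phi(d -) has a partial integral
       on the left, and S_C eps_C(L_q(r)) = eps_B(R_r(q)) because both have the
       same values under mu_B. Counitality and the mixed coassociativity express
       R_d(a) c and s L_q(r) through eps_B(R).
    2. If a is in N, left invariance applied to r a gives sum L_(a2)(r) a1 c = 0.
       By 1 this is u R_v(a) c = 0 summed over (s (x) 1)Delta_C(r) = u (x) v, hence
       R_v(a) = 0 for all v since the canonical map is onto.
    3. If R_d(e) = 0 for all d and (c (x) e) is the image of sum p (x) r under the
       canonical map, coassociativity and injectivity give sum p (x) R_d(r) = 0.
       With 1 and a dual basis this yields phi(sum p r) = 0, that is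
       phi(c S_C(eps_C(e))) = 0 for all c. As phi_B is onto, eps_C(e) = 0.
    4. For a in N and a right B-linear f : A -> B the element
       e = sum a2 S_C^-1(f(d a1)) lies in N, and eps_C(e) = 0 says f(d a) = 0.
       Projectivity provides enough maps f, so d a = 0 for all d and a = 0.

    The other three cases follow by passing to the opposite algebra (where the
    invariance appears in its phi_C S_C form and step 2 is shorter) and to the
    opposite comultiplication. *)

From HB Require Import structures.
Require Import Defs.
From mathcomp Require Import all_boot all_order all_algebra.
From mathcomp Require Import boolp finmap monalg.
From mathcomp Require Import reals complex.

Set Implicit Arguments.
Unset Strict Implicit.
Unset Printing Implicit Defensive.

Import GRing.Theory.
Local Open Scope ring_scope.

(** * Finite sums of elementary tensors *)

Section LinearMaps.
Context (K : fieldType) (U V : lmodType K) (f : U -> V) (lf : linear f).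

Lemma linear_at0 : f 0 = 0.
Proof. by have := lf (-1) 0 0; rewrite scaler0 addr0 scaleN1r addNr. Qed.

Lemma linear_scale k a : f (k *: a) = k *: f a.
Proof. by rewrite -[k *: a]addr0 lf linear_at0 addr0. Qed.

Lemma linear_sum_seq I (s : seq I) (G : I -> U) :
  f (\sum_(i <- s) G i) = \sum_(i <- s) f (G i).
Proof.
elim: s => [|i s IH]; first by rewrite !big_nil linear_at0.
by rewrite !big_cons -IH -[G i]scale1r lf !scale1r.
Qed.

End LinearMaps.

Section Bilinear.
Context (K : fieldType) (U V W : lmodType K).

Context (F : U -> V -> W) (bF : is_bilinear F).

Lemma bilinear_suml I (s : seq I) G v :
  F (\sum_(i <- s) G i) v = \sum_(i <- s) F (G i) v.
Proof. exact: (@linear_sum_seq K U W (F^~ v) (bF.1 v)). Qed.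

Lemma bilinear_sumr I (s : seq I) G u :
  F u (\sum_(i <- s) G i) = \sum_(i <- s) F u (G i).
Proof. exact: (@linear_sum_seq K V W (F u) (bF.2 u)). Qed.

Lemma bilinearZDl k u u' v : F (k *: u + u') v = k *: F u v + F u' v.
Proof. exact: bF.1. Qed.

Lemma bilinearZDr k u v v' : F u (k *: v + v') = k *: F u v + F u v'.
Proof. exact: bF.2. Qed.

Lemma bilinear0l v : F 0 v = 0.
Proof. exact: (@linear_at0 K U W (F^~ v) (bF.1 v)). Qed.

Lemma bilinear0r u : F u 0 = 0.
Proof. exact: (@linear_at0 K V W (F u) (bF.2 u)). Qed.

Lemma bilinearZl k u v : F (k *: u) v = k *: F u v.
Proof. by rewrite -[k *: u]addr0 bilinearZDl bilinear0l addr0. Qed.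

Lemma bilinearZr k u v : F u (k *: v) = k *: F u v.
Proof. by rewrite -[k *: v]addr0 bilinearZDr bilinear0r addr0. Qed.

End Bilinear.

Lemma bilinear_flip (K : fieldType) (U V W : lmodType K) (F : U -> V -> W) :
  is_bilinear F -> is_bilinear (fun v u => F u v).
Proof. by case. Qed.

(** A finite sum of elementary tensors is represented by the list of its
    terms, and [sw s F] is its image under the map u (x) v |-> F u v. *)
Section Sweedler.
Context (K : fieldType) (A : lmodType K).
Implicit Types s : seq (A * A).

Definition sw (V : lmodType K) s (F : A -> A -> V) : V :=
  \sum_(p <- s) F p.1 p.2.

Definition balanced (I : Type) (r l : I -> A -> A) (V : lmodType K)
    (F : A -> A -> V) : Prop :=
  is_bilinear F /\ forall i u v, F (r i u) v = F u (l i v).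

Definition flip_terms s := [seq (p.2, p.1) | p <- s].
Definition scale_terms k s := [seq (k *: p.1, p.2) | p <- s].

Lemma sw_flip (V : lmodType K) s (F : A -> A -> V) :
  sw (flip_terms s) F = sw s (fun u v => F v u).
Proof. by rewrite /sw big_map. Qed.

Lemma sw_scale (V : lmodType K) k s (F : A -> A -> V) :
  is_bilinear F -> sw (scale_terms k s) F = k *: sw s F.
Proof.
move=> bF; rewrite /sw big_map scaler_sumr; apply: eq_bigr => p _ /=.
exact: bilinearZl.
Qed.

Lemma sw_cat (V : lmodType K) s s' (F : A -> A -> V) :
  sw (s ++ s') F = sw s F + sw s' F.
Proof. exact: big_cat. Qed.

Lemma eq_sw (V : lmodType K) s (F G : A -> A -> V) :
  (forall u v, F u v = G u v) -> sw s F = sw s G.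
Proof. by move=> e; apply: eq_bigr => p _. Qed.

Lemma sw_linear (V W : lmodType K) (g : V -> W) s (F : A -> A -> V) :
  linear g -> g (sw s F) = sw s (fun u v => g (F u v)).
Proof. by move=> lg; rewrite /sw (linear_sum_seq lg). Qed.

End Sweedler.

(** * The two halves of a Hopf algebroid *)

Section Algebras.
Context (K : fieldType).

Record algebra_law (B : lmodType K) (m : B -> B -> B) : Prop := {
  law_bilinear : is_bilinear m;
  lawA : forall a b c, m a (m b c) = m (m a b) c
}.

Lemma algebra_law_op (B : lmodType K) (m : B -> B -> B) :
  algebra_law m -> algebra_law (fun a b => m b a).
Proof. by case=> b a; split; [exact: bilinear_flip|move=> *; rewrite a]. Qed.

(** The basis is indexed by A: [i] is its own basis vector. *)
Definition dual_basis (A B : lmodType K) (m : B -> B -> B)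
    (act : B -> A -> A) : Prop :=
  exists f : A -> {linear A -> B},
    (forall i x a, f i (act x a) = m x (f i a)) /\
    forall L : seq A, exists s : seq A,
      forall a, a \in L -> a = \sum_(i <- s) act (f i a) i.

End Algebras.

(** One half of the structure: the base algebras B and C act from one side,
    [ant] is the anti-isomorphism B -> C through which the tensor square is
    balanced, [dl a b] and [dr a b] stand for Delta(a)(b (x) 1) and
    Delta(a)(1 (x) b) when the actions are from the left, and for
    (b (x) 1)Delta(a) and (1 (x) b)Delta(a) when they are from the right. *)
Record side (K : fieldType) (A B C : lmodType K) := Side {
  bact : B -> A -> A;
  cact : C -> A -> A;
  ant : {linear B -> C};
  antV : {linear C -> B};
  cou : {linear A -> B};
  dl : A -> A -> seq (A * A);
  dr : A -> A -> seq (A * A)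
}.

Section Sides.
Context (K : fieldType) (A B C : lmodType K).

Definition bal (s : side A B C) (V : lmodType K) (F : A -> A -> V) : Prop :=
  balanced (bact s) (fun x => cact s (ant s x)) F.

(** [s] is the side under consideration and [o] the opposite one; for the right
    side the three products are reversed. *)
Record side_axioms (mA : A -> A -> A) (mB : B -> B -> B) (mC : C -> C -> C)
    (muB : {scalar B}) (muC : {scalar C}) (s o : side A B C) : Prop := {
  lawAA : algebra_law mA;
  lawB : algebra_law mB;
  lawC : algebra_law mC;
  nondeg : forall a, (forall b, mA a b = 0) -> a = 0;
  muB_faith : forall x, (forall x', muB (mB x x') = 0) -> x = 0;
  muC_faith : forall y, (forall y', muC (mC y y') = 0) -> y = 0;
  mu_ant : forall x, muC (ant s x) = muB x;
  bact_bilinear : is_bilinear (bact s);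
  cact_bilinear : is_bilinear (cact s);
  bactM : forall x a b, bact s x (mA a b) = mA (bact s x a) b;
  cactM : forall y a b, cact s y (mA a b) = mA (cact s y a) b;
  bact_mid : forall x a b, mA a (bact s x b) = mA (bact o x a) b;
  cact_mid : forall y a b, mA a (cact s y b) = mA (cact o y a) b;
  bact_comp : forall x x' a, bact s (mB x x') a = bact s x (bact s x' a);
  cact_comp : forall y y' a, cact s (mC y y') a = cact s y (cact s y' a);
  bcact : forall x y a, bact s x (cact s y a) = cact s y (bact s x a);
  bact_faith : forall x, (forall a, bact s x a = 0) -> x = 0;
  cact_faith : forall y, (forall a, cact s y a = 0) -> y = 0;
  antK : cancel (ant s) (antV s);
  antVK : cancel (antV s) (ant s);
  antM : forall x x', ant s (mB x x') = mC (ant s x') (ant s x);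
  b_basis : dual_basis mB (bact s);
  c_basis : dual_basis mC (cact s);
  cou_bact : forall x a, cou s (bact s x a) = mB x (cou s a);
  cou_cact : forall x a, cou s (cact s (ant s x) a) = mB (cou s a) x;
  cou_dr : forall a b,
    sw (dr s a b) (fun u v => cact s (ant s (cou s u)) v) = mA a b;
  cou_dl : forall a b,
    sw (dl s a b) (fun u v => bact s (cou s v) u) = mA a b;
  dr_dl : forall (V : lmodType K) (F : A -> A -> V) a b c, bal s F ->
    sw (dr s a c) (fun u v => F (mA u b) v) =
    sw (dl s a b) (fun u v => F u (mA v c));
  dl_lin_cov : forall (V : lmodType K) (F : A -> A -> V) k a a' b c, bal s F ->
    sw (dl s (k *: a + a') b) (fun u v => F u (mA v c)) =
    k *: sw (dl s a b) (fun u v => F u (mA v c)) +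
    sw (dl s a' b) (fun u v => F u (mA v c));
  dl_bal_cov : forall (V : lmodType K) (F : A -> A -> V) x a b c, bal s F ->
    sw (dl s a (bact s x b)) (fun u v => F u (mA v c)) =
    sw (dl s a b) (fun u v => F u (mA v (cact s (ant s x) c)));
  dl_mul_cov : forall (V : lmodType K) (F : A -> A -> V) a a' b c, bal s F ->
    sw (dl s (mA a a') b) (fun u v => F u (mA v c)) =
    sw (dl s a' b) (fun p q => sw (dl s a p) (fun u v => F u (mA v (mA q c))));
  dl_cact_cov : forall (V : lmodType K) (F : A -> A -> V) y a b c, bal s F ->
    sw (dl s (cact s y a) b) (fun u v => F u (mA v c)) =
    sw (dl s a b) (fun u v => F (cact s y u) (mA v c));
  dl_bact_cov : forall (V : lmodType K) (F : A -> A -> V) x a b c, bal s F ->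
    sw (dl s (bact s x a) b) (fun u v => F u (mA v c)) =
    sw (dl s a b) (fun u v => F u (bact s x (mA v c)));
  dl_cacto_cov : forall (V : lmodType K) (F : A -> A -> V) y a b c, bal s F ->
    sw (dl s (cact o y a) b) (fun u v => F u (mA v c)) =
    sw (dl s a (cact s y b)) (fun u v => F u (mA v c));
  dl_bacto_cov : forall (V : lmodType K) (F : A -> A -> V) x a b c, bal s F ->
    sw (dl s (bact o x a) b) (fun u v => F u (mA v c)) =
    sw (dl s a b) (fun u v => F u (mA v (bact s x c)))
}.

(** * Consequences of the axioms of one side *)

Section SideTheory.
Context (mA : A -> A -> A) (mB : B -> B -> B) (mC : C -> C -> C).
Context (muB : {scalar B}) (muC : {scalar C}) (s o : side A B C).
Hypothesis ax : side_axioms mA mB mC muB muC s o.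

Let mAb := law_bilinear (lawAA ax).
Let lb := bact_bilinear ax.
Let lc := cact_bilinear ax.
Let mulE := (bilinearZDl mAb, bilinearZDr mAb).
Let actE := (bilinearZDl lb, bilinearZDr lb, bilinearZDl lc, bilinearZDr lc).

Lemma bal_mulr (V : lmodType K) (F : A -> A -> V) c :
  bal s F -> bal s (fun u v => F u (mA v c)).
Proof.
case=> bF hF; split.
  by split=> [v|u] k a b; rewrite ?mulE (bilinearZDl bF, bilinearZDr bF).
by move=> x u v; rewrite hF (cactM ax).
Qed.

Lemma bal_cactl (V : lmodType K) (F : A -> A -> V) y :
  bal s F -> bal s (fun u v => F (cact s y u) v).
Proof.
case=> bF hF; split.
  by split=> [v|u] k a b; rewrite ?actE (bilinearZDl bF, bilinearZDr bF).
by move=> x u v; rewrite -(bcact ax) hF.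
Qed.

Lemma bal_bactr (V : lmodType K) (F : A -> A -> V) x :
  bal s F -> bal s (fun u v => F u (bact s x v)).
Proof.
case=> bF hF; split.
  by split=> [v|u] k a b; rewrite ?actE (bilinearZDl bF, bilinearZDr bF).
by move=> x' u v; rewrite hF (bcact ax).
Qed.

(** Non-degeneracy allows a test by multiplying with [b]: the opposite action then moves onto [b],
    where it no longer meets the action of [y]. *)
Lemma act_oppC x y a : bact o x (cact s y a) = cact s y (bact o x a).
Proof.
apply/eqP; rewrite -subr_eq0; apply/eqP; apply: (nondeg ax) => b.
have -> z w : mA (z - w) b = mA z b - mA w b.
  by rewrite addrC -scaleN1r mulE scaleN1r addrC.
rewrite -(bact_mid ax) -!(cactM ax) -(bact_mid ax) -?(cactM ax).
by rewrite subrr.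
Qed.

(** The slices of a tensor by the coordinates of a dual basis determine it, and
    they are elements of A, which is non-degenerate. *)
Lemma sw_sep (s1 : seq (A * A)) :
  (forall (V : lmodType K) (F : A -> A -> V) c, bal s F ->
     sw s1 (fun u v => F u (mA v c)) = 0) ->
  forall (V : lmodType K) (F : A -> A -> V), bal s F -> sw s1 F = 0.
Proof.
move=> h0 V F [bF hF]; have [f [fM fE]] := b_basis ax.
have {fE} [t tE] := fE [seq p.1 | p <- s1].
pose G i (u v : A) := cact s (ant s (f i u)) v.
have bG i : bal s (G i).
  split; first by split=> [v|u] k a b; rewrite /G ?linearP actE.
  by move=> x u v; rewrite /G fM (antM ax) (cact_comp ax).
have G0 i : sw s1 (G i) = 0.
  apply: (nondeg ax) => c.
  rewrite (@sw_linear _ _ _ _ (mA^~ c) _ _ (mAb.1 c)).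
  rewrite -[RHS](h0 _ (G i) c (bG i)); apply: eq_sw => u v.
  by rewrite /G (cactM ax).
(* Expanding the first leg in the dual basis gives coefficients [f i u]; balancedness of [F] moves
   them to the second leg, where they form the slices [G i]. *)
transitivity (\sum_(i <- t) F i (sw s1 (G i))); last first.
  by rewrite big1_seq // => i _; rewrite G0 (bilinear0r bF).
under [RHS]eq_bigr => i _ do rewrite /sw (bilinear_sumr bF).
rewrite exchange_big /=; apply: eq_big_seq => p ps.
rewrite {1}(tE p.1) ?map_f // (bilinear_suml bF).
by apply: eq_bigr => i _; rewrite hF.
Qed.

(** The difference of two sums is again a list of terms: [s2] scaled by -1 and appended to [s1]. So
    equality may be checked after multiplying the second leg by an arbitrary [c]. *)
Lemma sw_eq (s1 s2 : seq (A * A)) :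
  (forall (V : lmodType K) (F : A -> A -> V) c, bal s F ->
     sw s1 (fun u v => F u (mA v c)) = sw s2 (fun u v => F u (mA v c))) ->
  forall (V : lmodType K) (F : A -> A -> V), bal s F -> sw s1 F = sw s2 F.
Proof.
move=> h V F bF; apply/eqP; rewrite -subr_eq0 -scaleN1r; apply/eqP.
rewrite -(sw_scale _ _ bF.1) -sw_cat.
apply: sw_sep => // {F bF} V F c bF.
have /h e := bF; have bFc := bal_mulr c bF.
by rewrite sw_cat (sw_scale _ _ bFc.1) e scaleN1r subrr.
Qed.

Section Uncovered.
Context (V : lmodType K) (F : A -> A -> V) (bF : bal s F).

(** The axioms on [dl] hold with the second leg multiplied by some [c], because only then do the
    sums become values of the operators Delta(a). Here and in the lemmas that follow, [sw_eq]
    removes that factor. *)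
Lemma dl_linl k a a' b :
  sw (dl s (k *: a + a') b) F = k *: sw (dl s a b) F + sw (dl s a' b) F.
Proof.
rewrite -(sw_scale _ _ bF.1) -sw_cat; apply: sw_eq => // V' F' c bF'.
have bF'c := bal_mulr c bF'.
by rewrite sw_cat (sw_scale _ _ bF'c.1) (dl_lin_cov ax).
Qed.

Lemma dl_linr k a b b' :
  sw (dl s a (k *: b + b')) F = k *: sw (dl s a b) F + sw (dl s a b') F.
Proof.
rewrite -(sw_scale _ _ bF.1) -sw_cat; apply: sw_eq => // V' F' c bF'.
have bF'c := bal_mulr c bF'.
rewrite sw_cat (sw_scale _ _ bF'c.1) -!(dr_dl ax) // /sw scaler_sumr -big_split.
by apply: eq_bigr => p _; rewrite /= mulE (bilinearZDl bF'.1).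
Qed.

Lemma dl_bact x a b :
  sw (dl s (bact s x a) b) F = sw (dl s a b) (fun u v => F u (bact s x v)).
Proof.
transitivity (sw [seq (p.1, bact s x p.2) | p <- dl s a b] F).
  apply: sw_eq => // V' F' c bF'.
  rewrite (dl_bact_cov ax) // /sw big_map.
  by apply: eq_bigr => p _; rewrite /= (bactM ax).
by rewrite /sw big_map.
Qed.

Lemma dl_cacto y a b : sw (dl s (cact o y a) b) F = sw (dl s a (cact s y b)) F.
Proof. by apply: sw_eq => // V' F' c bF'; exact: (dl_cacto_cov ax). Qed.

Lemma dl_bacto x a b :
  sw (dl s (bact o x a) b) F = sw (dl s a b) (fun u v => F u (bact o x v)).
Proof.
transitivity (sw [seq (p.1, bact o x p.2) | p <- dl s a b] F).
  apply: sw_eq => // V' F' c bF'.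
  rewrite (dl_bacto_cov ax) // /sw big_map.
  by apply: eq_bigr => p _; rewrite /= (bact_mid ax).
by rewrite /sw big_map.
Qed.

Lemma dl_mul a a' b :
  sw (dl s (mA a a') b) F =
  sw (dl s a' b) (fun p q => sw (dr s a q) (fun u v => F (mA u p) v)).
Proof.
(* With p (x) q running through Delta(a')(b (x) 1), Delta(a)(p (x) q) is Delta(a)(1 (x) q) times p
   (x) 1; [t] lists the resulting terms, so that [sw_eq] applies. *)
pose t := flatten [seq [seq (mA w.1 p.1, w.2) | w <- dr s a p.2] | p <- dl s a' b].
have tE (V' : lmodType K) (F' : A -> A -> V') : sw t F' =
    sw (dl s a' b) (fun p q => sw (dr s a q) (fun u v => F' (mA u p) v)).
  rewrite /sw big_flatten big_map; apply: eq_bigr => p _.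
  by rewrite big_map.
rewrite -tE; apply: sw_eq => // V' F' c bF'; rewrite tE (dl_mul_cov ax) //.
apply: eq_sw => p q; rewrite (dr_dl ax _ _ _ (bal_mulr c bF')).
by apply: eq_sw => u v; rewrite (lawA (lawAA ax)).
Qed.

End Uncovered.
End SideTheory.
End Sides.

(** * Slices by an integral *)

Section TwoSides.
Context (K : fieldType) (A B C : lmodType K).

(** Coassociativity tested on trilinear maps, balanced for [s] in the first two legs and for [s'] in
    the last two. Equal sides give the two pure laws, different sides the two mixed ones. *)
Definition coassoc (s s' : side A B C) : Prop :=
  forall (V : lmodType K) (F : A -> A -> A -> V),
    (forall w, bal s (fun u v => F u v w)) -> (forall u, bal s' (F u)) ->
    forall a b c,
      sw (dr s' b c) (fun p q => sw (dl s p a) (fun u v => F u v q)) =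
      sw (dl s b a) (fun p q => sw (dr s' q c) (F p)).

Record hopf_axioms (mA : A -> A -> A) (mB : B -> B -> B) (mC : C -> C -> C)
    (muB : {scalar B}) (muC : {scalar C}) (l r : side A B C) : Prop := {
  side_l : side_axioms mA mB mC muB muC l r;
  side_r : side_axioms (fun a b => mA b a) (fun a b => mB b a)
                       (fun a b => mC b a) muB muC r l;
  mu_cou : forall a, muB (cou l a) = muB (cou r a);
  coassoc_ll : coassoc l l;
  coassoc_rr : coassoc r r;
  coassoc_lr : coassoc l r;
  coassoc_rl : coassoc r l
}.

Lemma hopf_axioms_op mA mB mC muB muC l r :
  hopf_axioms mA mB mC muB muC l r ->
  hopf_axioms (fun a b => mA b a) (fun a b => mB b a) (fun a b => mC b a)
              muB muC r l.
Proof. by case=> *; split. Qed.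

Section Slices.
Context (mA : A -> A -> A) (mB : B -> B -> B) (mC : C -> C -> C).
Context (muB : {scalar B}) (muC : {scalar C}) (l r : side A B C).
Hypothesis ax : hopf_axioms mA mB mC muB muC l r.
Context (phi : {scalar A}) (phiC : A -> C).
Hypothesis phiCP : forall y a, phi (cact r y a) = muC (mC (phiC a) y).

Let axl := side_l ax.
Let axr := side_r ax.
Let bmA := law_bilinear (lawAA axl).
Let bmB := law_bilinear (lawB axl).
Let bmC := law_bilinear (lawC axl).
Let linE := (bilinearZDl bmA, bilinearZDr bmA, bilinearZDl bmB, bilinearZDr bmB,
  bilinearZDl bmC, bilinearZDr bmC,
  bilinearZDl (bact_bilinear axl), bilinearZDr (bact_bilinear axl),
  bilinearZDl (cact_bilinear axl), bilinearZDr (cact_bilinear axl),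
  bilinearZDl (bact_bilinear axr), bilinearZDr (bact_bilinear axr),
  bilinearZDl (cact_bilinear axr), bilinearZDr (cact_bilinear axr)).

Lemma muC_inj y z : (forall y', muC (mC y y') = muC (mC z y')) -> y = z.
Proof.
move=> e; apply/eqP; rewrite -subr_eq0; apply/eqP; apply: (muC_faith axl) => y'.
by rewrite addrC -scaleN1r !linE linearP /= e mulN1r addNr.
Qed.

Lemma muB_inj x z : (forall x', muB (mB x x') = muB (mB z x')) -> x = z.
Proof.
move=> e; apply/eqP; rewrite -subr_eq0; apply/eqP; apply: (muB_faith axl) => y'.
by rewrite addrC -scaleN1r !linE linearP /= e mulN1r addNr.
Qed.

Lemma phiC_linear : linear phiC.
Proof.
move=> k a b; apply: muC_inj => y.
by rewrite -phiCP !linE !linearP /= !phiCP.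
Qed.

Lemma phiC_act y a : phiC (cact r y a) = mC (phiC a) y.
Proof.
apply: muC_inj => y'.
by rewrite -phiCP -(cact_comp axr) phiCP (lawA (lawC axl)).
Qed.

(** C need not have a unit, so [a] is first written by a dual basis as a sum of elements
    [cact r y i]; on these the defining property of [phiC] applies. *)
Lemma phiC_total a : phi a = muC (phiC a).
Proof.
have [f [_ /(_ [:: a]) [s /(_ a)]]] := c_basis axr.
rewrite mem_head => /(_ isT) ->.
rewrite (linear_sum_seq phiC_linear) !linear_sum /=.
by apply: eq_bigr => i _; rewrite phiCP phiC_act.
Qed.

(** sum a1 S_C(phiC(d a2)), with (1 (x) d)Delta_C(a) = sum a1 (x) d a2. *)
Definition slice d a : A :=
  sw (dr r a d) (fun u v => bact r (antV r (phiC v)) u).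

Lemma antVM y y' : antV r (mC y y') = mB (antV r y') (antV r y).
Proof.
rewrite -[y in LHS](antVK axr) -[y' in LHS](antVK axr).
by rewrite -(antM axr) (antK axr).
Qed.

Lemma bal_slice : bal r (fun u v => bact r (antV r (phiC v)) u).
Proof.
split.
  by split=> [v|u] k a b; rewrite ?linE ?phiC_linear ?linearP ?linE.
move=> x u v /=.
by rewrite phiC_act antVM (antK axr) -(bact_comp axr).
Qed.

(** Multiplying by [e] replaces (1 (x) d)Delta_C(a) by (e (x) 1)Delta_C(a), to which the axioms on
    [dl] refer. Together with [nondeg_r] this yields the rules for slices below. *)
Lemma slice_cov e d a : mA e (slice d a) =
  sw (dl r a e) (fun u v => bact r (antV r (phiC (mA d v))) u).
Proof.
rewrite /slice (@sw_linear _ _ _ _ (mA e) _ _ (bmA.2 e)).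
rewrite -(dr_dl axr a e d bal_slice).
by apply: eq_sw => u v; rewrite (bactM axr).
Qed.

Lemma nondeg_r a b : (forall e, mA e a = mA e b) -> a = b.
Proof.
move=> h; apply/eqP; rewrite -subr_eq0; apply/eqP; apply: (nondeg axr) => e.
by rewrite addrC -scaleN1r !linE h scaleN1r addNr.
Qed.

Lemma slice_linear_l a : linear (slice^~ a).
Proof.
move=> k d d'; apply: nondeg_r => e; rewrite linE !slice_cov.
rewrite /sw scaler_sumr -big_split; apply: eq_bigr => p _ /=.
by rewrite !linE phiC_linear linearP !linE.
Qed.

Lemma slice_linear_r d : linear (slice d).
Proof.
move=> k a b; apply: nondeg_r => e; rewrite linE !slice_cov.
exact: (dl_lin_cov axr k a b e d bal_slice).
Qed.

Lemma slice_bal y d a : slice (cact r y d) a = bact l (antV r y) (slice d a).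
Proof.
apply: nondeg_r => e; rewrite (bact_mid axl) !slice_cov.
have := dl_bal_cov axr (antV r y) a e d bal_slice.
by rewrite (antVK axr) /= => ->.
Qed.

Lemma slice_cactl y d a : slice d (cact l y a) = cact l y (slice d a).
Proof.
apply: nondeg_r => e; rewrite (cact_mid axl) !slice_cov.
exact: (dl_cacto_cov axr y a e d bal_slice).
Qed.

Lemma slice_cactr y d a : slice d (cact r y a) = cact r y (slice d a).
Proof.
apply: nondeg_r => e; rewrite -(cactM axr) !slice_cov.
rewrite (dl_cact_cov axr y a e d bal_slice).
rewrite [RHS](@sw_linear _ _ _ _ (cact r y) _ _ ((cact_bilinear axr).2 y)).
by apply: eq_sw => u v; rewrite (bcact axr).
Qed.

(** The counit of the first leg can be moved through [phiC] onto the second leg, where the counit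
    axiom collapses the sum to d a. *)
Lemma cour_slice d a : cou r (slice d a) = antV r (phiC (mA d a)).
Proof.
rewrite /slice (@sw_linear _ _ _ _ (cou r)); last exact: linearP.
rewrite -(cou_dr axr a d) (@sw_linear _ _ _ _ (fun z => antV r (phiC z))); last first.
  by move=> k x y; rewrite phiC_linear linearP.
  by apply: eq_sw => u v; rewrite (cou_bact axr) phiC_act antVM (antK axr).
Qed.

(** The factor [x] is absorbed into [a]; then [muB] does not distinguish the two counits, and the
    right counit of a slice is known. *)
Lemma mu_coul_slice d a x :
  muB (mB (cou l (slice d a)) x) = phi (mA d (cact l (ant l x) a)).
Proof.
rewrite -(cou_cact axl) -slice_cactl (mu_cou ax) cour_slice phiC_total.
by rewrite -(mu_ant axr) (antVK axr).
Qed.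

(** Apply the counit to the middle leg of a1 c (x) a2 (x) d a3. *)
Lemma slice_mulr d a c : mA (slice d a) c =
  sw (dl l a c) (fun u v => bact l (cou l (slice d v)) u).
Proof.
have bF w : bal l (fun u v => bact l (cou l (bact r (antV r (phiC w)) v)) u).
  split; first by split=> [v|u] k x y; rewrite ?linE ?linearP ?linE.
  move=> x u v /=.
  by rewrite -(bact_comp axl) -(cou_cact axl) (act_oppC axl).
have bG : bal l (fun u v => bact l (cou l v) u).
  split; first by split=> [v|u] k x y; rewrite ?linE ?linearP ?linE.
  by move=> x u v /=; rewrite (cou_cact axl) (bact_comp axl).
rewrite {1}/slice (@sw_linear _ _ _ _ (mA^~ c) _ _ (bmA.1 c)).
have := coassoc_lr ax (F := fun u v w =>
  bact l (cou l (bact r (antV r (phiC w)) v)) u) bF _ c a d.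
rewrite [in X in _ -> X]/slice => e.
transitivity (sw (dr r a d) (fun p q =>
  sw (dl l p c) (fun u v => bact l (cou l (bact r (antV r (phiC q)) v)) u))).
  apply: eq_sw => u v; rewrite -(cou_dl axl).
  by rewrite (dl_bacto axl bG).
rewrite e; last first.
  move=> u; split.
    by split=> [v|w] k x y; rewrite ?phiC_linear !(linE, linearP).
  by move=> x v w; rewrite phiC_act antVM (antK axr) -(bact_comp axr).
apply: eq_sw => u v.
rewrite (@sw_linear _ _ _ _ (fun z => bact l (cou l z) u)) //.
by move=> k x y; rewrite linearP linE.
Qed.

End Slices.
End TwoSides.

(** * The null ideal of an integral *)

Section Core.
Context (K : fieldType) (A B C : lmodType K).

(** The canonical map sends u (x) v to [dl r v u]. Its surjectivity, and below its injectivity, are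
    expressed by testing against all balanced maps, so that no tensor product space is mentioned. *)
Definition canonical_surj (r : side A B C) : Prop :=
  forall p q, exists t : seq (A * A), forall (V : lmodType K) (F : A -> A -> V),
    bal r F -> sw t (fun u v => sw (dl r v u) F) = F p q.

Definition canonical_inj (l r : side A B C) : Prop :=
  forall t : seq (A * A),
    (forall (V : lmodType K) (F : A -> A -> V), bal r F ->
       sw t (fun u v => sw (dl r v u) F) = 0) ->
    forall (V : lmodType K) (G : A -> A -> V),
      balanced (cact r) (cact l) G -> sw t G = 0.

Context (mA : A -> A -> A) (mB : B -> B -> B) (mC : C -> C -> C).
Context (muB : {scalar B}) (muC : {scalar C}) (l r : side A B C).
Hypothesis ax : hopf_axioms mA mB mC muB muC l r.
Hypothesis surj_r : canonical_surj r.
Hypothesis inj_r : canonical_inj l r.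
Context (phi : {scalar A}) (phiB : A -> B) (Cphi phiC : A -> C).
Hypothesis phiBP : forall x a, phi (bact r x a) = muB (mB (phiB a) x).
Hypothesis CphiP : forall y a, phi (cact l y a) = muC (mC y (Cphi a)).
Hypothesis phiCP : forall y a, phi (cact r y a) = muC (mC (phiC a) y).

Let axl := side_l ax.
Let axr := side_r ax.
Let bmA := law_bilinear (lawAA axl).
Let bmB := law_bilinear (lawB axl).
Let bmC := law_bilinear (lawC axl).
Let linE := (bilinearZDl bmA, bilinearZDr bmA, bilinearZDl bmB, bilinearZDr bmB,
  bilinearZDl bmC, bilinearZDr bmC,
  bilinearZDl (bact_bilinear axl), bilinearZDr (bact_bilinear axl),
  bilinearZDl (cact_bilinear axl), bilinearZDr (cact_bilinear axl),
  bilinearZDl (bact_bilinear axr), bilinearZDr (bact_bilinear axr),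
  bilinearZDl (cact_bilinear axr), bilinearZDr (cact_bilinear axr)).

Notation R := (slice r phiC).
Notation L := (slice l Cphi).

Let axo := hopf_axioms_op ax.
Let R_linl := slice_linear_l ax phiCP.
Let R_linr := slice_linear_r ax phiCP.

Definition null a := forall b, phi (mA b a) = 0.

Lemma bal_mul_slice a : bal r (fun u v => mA u (R v a)).
Proof.
split; first by split=> [v|u] k x y; rewrite ?R_linl !linE.
move=> x u v; rewrite (slice_bal ax phiCP) (antK axr).
by rewrite (bact_mid axl).
Qed.

(** Multiplied by [x] on the right and evaluated by [muB], both sides become [phi] of the product v
    S_B(x) q. *)
Lemma cour_slicel q v : cou r (L q v) = cou l (R v q).
Proof.
apply: (muB_inj ax) => x; rewrite (mu_coul_slice ax phiCP) -(cou_bact axr).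
have := slice_bal axo CphiP (ant l x) q v; rewrite (antK axl) => <-.
rewrite -(mu_cou ax) (cour_slice axo CphiP) (phiC_total axo CphiP).
by rewrite -(mu_ant axl) (antVK axl).
Qed.

Lemma Cphi_null a b : null a -> Cphi (mA b a) = 0.
Proof.
move=> na; apply: (muC_faith axr) => y.
by rewrite -CphiP (cactM axl).
Qed.

(** Left invariance is used at b a, with Delta_B(b a) = Delta_B(b)Delta_B(a); since [Cphi] vanishes
    on A a, a vanishing sum of slices results. *)
Lemma slice_null1 :
  (forall a b, sw (dl l b a) (fun u v => bact l (antV l (Cphi v)) u) =
               cact l (Cphi b) a) ->
  forall a, null a -> forall d, R d a = 0.
Proof.
move=> inv a na d.
have balL := bal_slice axo CphiP.
(* The sum of u R_v(a) c over (s (x) 1)Delta_C(b) is s times the invariance identity at b a and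
   [c]. *)
have key c b s : sw (dl r b s) (fun u v => mA u (mA (R v a) c)) = 0.
  transitivity (mA s (cact l (Cphi (mA b a)) c)); last first.
    by rewrite Cphi_null // (bilinear0l (cact_bilinear axl)) (bilinear0r bmA).
  rewrite -inv (dl_mul axl balL) (@sw_linear _ _ _ _ (mA s) _ _ (bmA.2 s)).
  (* The common form of both sides, with p (x) q running through Delta_B(a)(c (x) 1): on one side
     R_v(a) c is expanded by [slice_mulr], on the other s L_q(b) by its mirror image, and
     [cour_slicel] matches the counits. *)
  transitivity (sw (dl l a c) (fun p q =>
      sw (dl r b s) (fun u v => mA u (bact l (cou l (R v q)) p)))).
    rewrite /sw exchange_big /=; apply: eq_bigr => w _.
    rewrite (slice_mulr ax phiCP) (@sw_linear _ _ _ _ (mA w.1) _ _ (bmA.2 _)).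
    by [].
  apply: eq_sw => p q.
  transitivity (mA (mA s (L q b)) p); last first.
    rewrite -(lawA (lawAA axl)) {1}/slice.
    rewrite (@sw_linear _ _ _ _ (mA^~ p) _ _ (bmA.1 p)); congr (mA s _).
    by apply: eq_sw => u v; rewrite (bactM axl).
  have := slice_mulr axo CphiP q b s => /= ->.
  rewrite (@sw_linear _ _ _ _ (mA^~ p) _ _ (bmA.1 p)).
  by apply: eq_sw => u v; rewrite cour_slicel (bact_mid axl).
apply: (nondeg axl) => c; apply: (nondeg axr) => e.
(* A preimage of e (x) d under the canonical map turns the vanishing sums into e R_d(a) c = 0. *)
have [t tE] := surj_r e d.
have bF : bal r (fun u v => mA u (mA (R v a) c)).
  case: (bal_mul_slice a) => _ h; split.
    by split=> [v|u] k x y; rewrite ?R_linl !linE.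
  by move=> x u v; rewrite !(lawA (lawAA axl)) h.
rewrite -(tE _ _ bF) /sw big1 // => p _; exact: key.
Qed.

(** In this form invariance at b a reads directly as the sum of u R_v(a) over (s (x) 1)Delta_C(b)
    being s phi_C(b a); no passage through counits is needed. *)
Lemma slice_null2 :
  (forall a b, sw (dl r b a) (fun u v => bact r (antV r (phiC v)) u) =
               cact r (phiC b) a) ->
  forall a, null a -> forall d, R d a = 0.
Proof.
move=> inv a na d.
have balR := bal_slice ax phiCP.
(* Invariance makes [phiC] a module map for the other action of C too; hence [phiC] vanishes on A
   a. *)
have phiC_l y b : phiC (cact l y b) = mC y (phiC b).
  apply/eqP; rewrite -subr_eq0; apply/eqP; apply: (cact_faith axr) => c.
  rewrite addrC -scaleN1r linE scaleN1r (cact_comp axr) -!inv.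
  by rewrite (dl_cacto axr balR) addNr.
have phiC0 b : phiC (mA b a) = 0.
  apply: (muC_faith axr) => y.
  by rewrite -phiC_l -(phiC_total ax phiCP) (cactM axl).
apply: (nondeg axr) => c; have [t tE] := surj_r c d.
rewrite -(tE _ _ (bal_mul_slice a)); apply: big1 => p _ /=.
transitivity (cact r (phiC (mA p.2 a)) p.1); last first.
  by rewrite phiC0 (bilinear0l (cact_bilinear axr)).
have /= e := dl_mul axr balR a p.2 p.1.
rewrite -inv e /=. apply: eq_sw => u v.
rewrite /slice (@sw_linear _ _ _ _ (mA u) _ _ (bmA.2 u)).
by apply: eq_sw => u' v'; rewrite (bactM axr).
Qed.

(** By coassociativity Delta_C(R_d(v)) arises from Delta_C(v) by applying R_d to the second leg. So
    the canonical map sends the sum of u (x) R_d(v) to c (x) R_d(e) = 0, and injectivity applies. *)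
Lemma slice_inv_canonical (t : seq (A * A)) c e d : R d e = 0 ->
  (forall (V : lmodType K) (F : A -> A -> V), bal r F ->
     sw t (fun u v => sw (dl r v u) F) = F c e) ->
  forall (V : lmodType K) (G : A -> A -> V),
    balanced (cact r) (cact l) G -> sw t (fun u v => G u (R d v)) = 0.
Proof.
move=> R0 tE V G bG.
transitivity (sw [seq (p.1, R d p.2) | p <- t] G); first by rewrite /sw big_map.
apply: inj_r => // {V G bG} V F bF.
transitivity (sw t (fun u v => sw (dl r (R d v) u) F)).
  by rewrite [LHS]big_map.
have bF' : bal r (fun p q => F p (R d q)).
  split.
    by split=> [v|u] k x y; rewrite ?R_linr (bilinearZDl bF.1, bilinearZDr bF.1).
  by move=> x u v; rewrite bF.2 (slice_cactr ax phiCP).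
have := tE _ _ bF'; rewrite R0 (bilinear0r bF.1) => <-.
apply: eq_sw => p1 p2.
rewrite {1}/slice (@sw_linear _ _ _ _ (fun z => sw (dl r z p1) F)); last first.
  by move=> k a b; rewrite (dl_linl axr).
have := coassoc_rr ax (F := fun u v w => F u (bact r (antV r (phiC w)) v))
  _ _ p1 p2 d.
have bF1 w : bal r (fun u v => F u (bact r (antV r (phiC w)) v)).
  exact: (bal_bactr axr).
have bF2 u : bal r (fun v w => F u (bact r (antV r (phiC w)) v)).
  case: (bal_slice ax phiCP) => bS hS; split.
    by split=> [v|v] k x y; rewrite (bilinearZDl bS, bilinearZDr bS)
      (bilinearZDr bF.1).
  by move=> x v w; rewrite hS.
move=> /(_ bF1 bF2) e1.
transitivity (sw (dr r p2 d) (fun p q =>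
  sw (dl r p p1) (fun u v => F u (bact r (antV r (phiC q)) v)))).
  by apply: eq_sw => u v; rewrite (dl_bact axr).
rewrite e1; apply: eq_sw => u v.
by rewrite /slice (@sw_linear _ _ _ _ (F u) _ _ (bF.1.2 u)).
Qed.

Section Faithful.
Hypothesis phiB_surj : surjective phiB.
Hypothesis slice_null : forall a, null a -> forall d, R d a = 0.

Lemma cou_null e : null e -> cou r e = 0.
Proof.
(* Fullness enters here: every test element of B has the form [phiB c], which turns the claim into a
   statement about [phi]. *)
move=> ne; apply: (muB_faith axr) => x; have [c <-] := phiB_surj x.
rewrite -phiBP; have [t tE] := surj_r c e.
have bF : bal r (fun u v => bact r (cou r v) u).
  split; first by split=> [v|u] k x1 y; rewrite ?linearP !linE.
  by move=> x1 u v; rewrite (cou_cact axr) (bact_comp axr).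
rewrite -(tE _ _ bF).
under eq_sw => u v do rewrite (cou_dl axr).
(* What remains is the sum of phi(u v) over [t], a preimage of c (x) e. Expanding u over C and
   moving the coefficients [f i u] to v produces values of the form in [mu_coul_slice]. *)
have [f [fM /(_ [seq p.1 | p <- t]) [s sE]]] := c_basis axr.
have bG : balanced (cact r) (cact l) (fun u v => cact r (ant l (cou l v)) u).
  split; first by split=> [v|u] k x1 y; rewrite ?linearP ?linearP !linE.
  move=> y u v; rewrite -{2}[y](antVK axl) (cou_cact axl) (antM axl) (antVK axl).
  by rewrite (cact_comp axr).
rewrite /sw linear_sum /=.
transitivity (\sum_(i <- s)
    muC (f i (sw t (fun u v => cact r (ant l (cou l (R i v))) u)))); last first.
  apply: big1_seq => i _.
  by rewrite (slice_inv_canonical (slice_null ne i) tE bG) !linear0.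
transitivity (\sum_(p <- t) \sum_(i <- s) phi (mA i (cact l (f i p.1) p.2))).
  apply: eq_big_seq => p pt; rewrite {1}(sE p.1) ?map_f //.
  rewrite (bilinear_suml bmA) linear_sum; apply: eq_bigr => i _.
  by rewrite (cact_mid axl).
rewrite exchange_big; apply: eq_bigr => i _; rewrite /sw !linear_sum.
apply: eq_bigr => p _; rewrite fM -[f i p.1 in LHS](antVK axl).
rewrite -(mu_coul_slice ax phiCP) -(mu_ant axl) (antM axl) (antVK axl).
by [].
Qed.

Lemma null_eq0 a : null a -> a = 0.
Proof.
move=> na; apply: (nondeg axr) => d.
have [f [fM /(_ [:: mA d a]) [s /(_ _ (mem_head _ _)) ->]]] := b_basis axr.
apply: big1_seq => i _; suff -> : f i (mA d a) = 0.
  exact: (bilinear0l (bact_bilinear axr)).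
rewrite -(cou_dl axr a d) (@sw_linear _ _ _ _ (f i)); last exact: linearP.
(* The coordinate [f i] of d a is the counit of a slice of (d (x) 1)Delta_C(a) in its first leg, so
   it is enough that this slice is null. *)
transitivity (cou r (sw (dl r a d) (fun u v => cact r (ant r (f i u)) v))).
  rewrite (@sw_linear _ _ _ _ (cou r)); last exact: linearP.
  by apply: eq_sw => u v; rewrite fM (cou_cact axr).
apply: cou_null => b.
(* Slicing the first leg by [f i] and the second by [phi] commute, so [phi] of [b] times the new
   element is expressed through R_b(a) = 0. *)
transitivity (muB (f i (mA d (R b a)))); last first.
  by rewrite slice_null // (bilinear0r bmA) !linear0.
rewrite (slice_cov ax phiCP) (@sw_linear _ _ _ _ (mA b) _ _ (bmA.2 b)).
rewrite /sw !linear_sum; apply: eq_bigr => p _ /=.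
rewrite fM -(mu_ant axr) (antM axr) (antVK axr) -phiCP.
by rewrite (cactM axr).
Qed.

End Faithful.
End Core.

(** * The opposite comultiplication *)

Section CoOpposite.
Context (K : fieldType) (A B C : lmodType K).

(** Exchanging the legs swaps B with C and [dl] with [dr], and inverts [ant]. The counit is composed
    with [ant s] so that its values lie in C. *)
Definition co_side (s : side A B C) : side A C B :=
  Side (cact s) (bact s) (antV s) (ant s) (ant s \o cou s)
       (fun a b => flip_terms (dr s a b)) (fun a b => flip_terms (dl s a b)).

Lemma bal_co mA mB mC muB muC (s o : side A B C) :
  side_axioms mA mB mC muB muC s o ->
  forall (V : lmodType K) (F : A -> A -> V),
    bal (co_side s) F -> bal s (fun u v => F v u).
Proof.
move=> ax V F [bF hF]; split; first exact: bilinear_flip.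
by move=> x u v; rewrite hF /= (antK ax).
Qed.

Lemma side_axioms_co mA mB mC muB muC (s o : side A B C) :
  side_axioms mA mB mC muB muC s o ->
  side_axioms mA mC mB muC muB (co_side s) (co_side o).
Proof.
move=> ax.
have antVM x y : antV s (mC x y) = mB (antV s y) (antV s x).
  rewrite -[x in LHS](antVK ax) -[y in LHS](antVK ax).
  by rewrite -(antM ax) (antK ax).
(* A covered sum for the exchanged legs is one for [s] with the two covering elements interchanged;
   the axioms on [dl] are translated by this. *)
have covE (V : lmodType K) (F : A -> A -> V) a b c : bal (co_side s) F ->
    sw (dl (co_side s) a b) (fun u v => F u (mA v c)) =
    sw (dl s a c) (fun u v => F (mA v b) u).
  by move=> /(bal_co ax) bF; rewrite sw_flip (dr_dl ax a c b bF).
split=> /=; try by [case: ax].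
- by move=> y; rewrite -(mu_ant ax) (antVK ax).
- by move=> y a; rewrite -{1}[y](antVK ax) (cou_cact ax) (antM ax) (antVK ax).
- by move=> y a; rewrite (cou_bact ax) (antM ax) (antVK ax).
- move=> a b; rewrite sw_flip -[RHS](cou_dl ax).
  by apply: eq_sw => u v; rewrite (antK ax).
- by move=> a b; rewrite sw_flip -[RHS](cou_dr ax).
- move=> V F a b c /(bal_co ax) bF; rewrite !sw_flip.
  by rewrite -(dr_dl ax a c b bF).
- move=> V F k a a' b c bF; rewrite !covE //.
  exact: (dl_lin_cov ax _ _ _ _ _ (bal_co ax bF)).
- move=> V F y a b c bF; rewrite !covE //.
  by rewrite (dl_bal_cov ax _ _ _ _ (bal_co ax bF)) (antVK ax).
- move=> V F a a' b c bF; rewrite covE //; have bF' := bal_co ax bF.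
  rewrite (dl_mul_cov ax _ _ _ _ bF') sw_flip.
  under [RHS]eq_sw => u v do rewrite covE //.
  have := dr_dl ax a' c b (F := fun p q =>
    sw (dl s a p) (fun u v => F (mA v q) u)) _.
  move=> -> //; split; first split.
  + by move=> v k x y; rewrite (dl_linr ax (bal_mulr ax v bF')).
  + move=> u k x y; rewrite /sw scaler_sumr -big_split; apply: eq_bigr => p _.
    by rewrite /= (bilinearZDr (law_bilinear (lawAA ax))) (bilinearZDl bF.1).
  + by move=> x u v; rewrite (dl_bal_cov ax _ _ _ _ bF').
- move=> V F x a b c bF; rewrite covE // sw_flip; have bF' := bal_co ax bF.
  rewrite (dl_bact_cov ax _ _ _ _ bF').
  by rewrite -(dr_dl ax a c b (bal_bactr ax x bF')).
- move=> V F y a b c bF; rewrite covE // sw_flip; have bF' := bal_co ax bF.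
  rewrite (dl_cact_cov ax _ _ _ _ bF').
  by rewrite -(dr_dl ax a c b (bal_cactl ax y bF')).
- move=> V F x a b c bF; rewrite !covE //.
  by rewrite (dl_bacto_cov ax _ _ _ _ (bal_co ax bF)).
- move=> V F y a b c bF; rewrite !covE //.
  by rewrite (dl_cacto_cov ax _ _ _ _ (bal_co ax bF)).
Qed.

(** Reading the three legs backwards exchanges the two sides of the identity and the roles of [s]
    and [s']. *)
Lemma coassoc_co mA mB mC muB muC mA' mB' mC' muB' muC' (s s' o o' : side A B C) :
  side_axioms mA mB mC muB muC s o ->
  side_axioms mA' mB' mC' muB' muC' s' o' ->
  coassoc s s' -> coassoc (co_side s') (co_side s).
Proof.
move=> ax ax' h V F b1 b2 a b c; rewrite !sw_flip.
under eq_sw => u v do rewrite sw_flip.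
under [RHS]eq_sw => u v do rewrite sw_flip.
have := h _ (fun u v w => F w v u) _ _ c b a => -> //.
- by move=> w; exact: (bal_co ax (b2 w)).
- by move=> u; exact: (bal_co ax' (b1 u)).
Qed.

Lemma hopf_axioms_co mA mB mC muB muC (l r : side A B C) :
  hopf_axioms mA mB mC muB muC l r ->
  hopf_axioms mA mC mB muC muB (co_side l) (co_side r).
Proof.
move=> ax; have [axl axr] := (side_l ax, side_r ax).
split.
- exact: side_axioms_co.
- exact: side_axioms_co.
- by move=> a; rewrite /= (mu_ant axl) (mu_ant axr) (mu_cou ax).
- exact: (coassoc_co axl axl (coassoc_ll ax)).
- exact: (coassoc_co axr axr (coassoc_rr ax)).
- exact: (coassoc_co axr axl (coassoc_rl ax)).
- exact: (coassoc_co axl axr (coassoc_lr ax)).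
Qed.

End CoOpposite.

(** * Dual bases of projective modules *)

Section TensorTerms.
Context (K : fieldType) (M N : lmodType K) (I : Type).
Context (r : I -> M -> M) (l : I -> N -> N).
Notation T := (tensor r l).

(** A chosen list of elementary tensors with sum [t]; the coefficients of the representative are
    absorbed into the first factors. *)
Definition terms (t : T) : seq (M * N) :=
  [seq ((repr t)@_x *: x.1, x.2) | x <- msupp (repr t)].

Lemma tens_bilinear : is_bilinear (tens : M -> N -> T).
Proof.
have Z k m n : tens (k *: m) n = k *: tens m n :> T.
  rewrite /tens /presented_gen -[RHS]presented_classZ.
  by apply/presented_classP/SpanRel; exact: TensorZl.
have Z' k m n : tens m (k *: n) = k *: tens m n :> T.
  rewrite /tens /presented_gen -[RHS]presented_classZ.
  by apply/presented_classP/SpanRel; exact: TensorZr.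
split=> [n|m] k a b.
- rewrite -Z /tens /presented_gen -[RHS]presented_classD.
  by apply/presented_classP/SpanRel; rewrite opprD addrA; exact: TensorDl.
- rewrite -Z' /tens /presented_gen -[RHS]presented_classD.
  by apply/presented_classP/SpanRel; rewrite opprD addrA; exact: TensorDr.
Qed.

Lemma tens_balanced i m n : tens (r i m) n = tens m (l i n) :> T.
Proof. by apply/presented_classP/SpanRel; exact: TensorBal. Qed.

Lemma tlift_sum (V : lmodType K) (F : M -> N -> V) t :
  tlift F (t : T) = \sum_(x <- msupp (repr t)) (repr t)@_x *: F x.1 x.2.
Proof. by []. Qed.

Lemma eq_tlift (V : lmodType K) (F G : M -> N -> V) (t : T) :
  (forall u v, F u v = G u v) -> tlift F t = tlift G t.
Proof. by move=> e; rewrite !tlift_sum; apply: eq_bigr => x _; rewrite e. Qed.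

Lemma tlift_terms (V : lmodType K) (F : M -> N -> V) (t : T) : is_bilinear F ->
  tlift F t = \sum_(p <- terms t) F p.1 p.2.
Proof.
move=> bF; rewrite tlift_sum big_map; apply: eq_bigr => x _.
by rewrite (bilinearZl bF).
Qed.

Lemma termsE t : t = \sum_(p <- terms t) tens p.1 p.2.
Proof.
rewrite -(tlift_terms _ tens_bilinear) tlift_sum -[LHS]presented_classK.
rewrite {1}[repr t]monalgE.
have lin : linear (@presented_class K _ (tensor_rel r l)).
  by move=> k a b; rewrite presented_classD presented_classZ.
rewrite (linear_sum_seq lin); apply: eq_bigr => x _.
rewrite /tens -surjective_pairing /presented_gen -[RHS]presented_classZ.
by congr presented_class; apply/malgP => k; rewrite mcoeffZ !mcoeffU mulrnAr mulr1.
Qed.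

Lemma tens_ext (V : lmodType K) (f g : T -> V) : linear f -> linear g ->
  (forall m n, f (tens m n) = g (tens m n)) -> f =1 g.
Proof.
move=> lf lg h t; rewrite (termsE t) (linear_sum_seq lf) (linear_sum_seq lg).
by apply: eq_bigr => p _.
Qed.

End TensorTerms.

Section TensorMaps.
Context (K : fieldType) (M N M' N' : lmodType K) (I I' : Type).
Context (r : I -> M -> M) (l : I -> N -> N).
Context (r' : I' -> M' -> M') (l' : I' -> N' -> N').
Context (f : M -> M') (g : N -> N') (lf : linear f) (lg : linear g).
Hypothesis fg : forall i m n,
  tens (f (r i m)) (g n) = tens (f m) (g (l i n)) :> tensor r' l'.

Lemma tmapP : linear (tmap f g : tensor r l -> tensor r' l') /\
  forall m n, tmap f g (tens m n : tensor r l) = tens (f m) (g n) :> tensor r' l'.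
Proof.
have bt := @tens_bilinear K M' N' I' r' l'.
apply: (tliftP (f := fun m n => tens (f m) (g n))); last exact: fg.
by split=> [n|m] k a b; rewrite ?lf ?lg (bilinearZDl bt, bilinearZDr bt).
Qed.

Lemma tlift_tmap (V : lmodType K) (F : M' -> N' -> V) (t : tensor r l) :
  is_bilinear F -> (forall i m n, F (r' i m) n = F m (l' i n)) ->
  tlift F (tmap f g t : tensor r' l') = tlift (fun m n => F (f m) (g n)) t.
Proof.
move=> bF hF; have [lF FE] := tliftP bF hF; have [lt tE] := tmapP.
have bF' : is_bilinear (fun m n => F (f m) (g n)).
  by split=> [n|m] k a b; rewrite ?lf ?lg (bilinearZDl bF, bilinearZDr bF).
rewrite (tlift_terms _ bF') {1}(termsE t) (linear_sum_seq lt).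
rewrite (linear_sum_seq lF); apply: eq_bigr => p _.
by rewrite tE FE.
Qed.

End TensorMaps.

Lemma scale_add_exchange (K : fieldType) (V : lmodType K) (k c : K)
    (u v u' v' : V) :
  k *: (c *: u + v) + (c *: u' + v') = c *: (k *: u + u') + (k *: v + v').
Proof. by rewrite !scalerDr !scalerA (mulrC k) addrACA. Qed.

Section DualBasis.
Context (K : fieldType) (B : lmodType K) (m : B -> B -> B) (lawm : algebra_law m).
Context (P : lmodType K) (act : B -> P -> P).

Definition module_law (M : lmodType K) (a : B -> M -> M) : Prop :=
  is_bilinear a /\ forall x y v, a (m x y) v = a x (a y v).

Hypothesis actP : module_law act.
Hypothesis act_full : forall a : P, exists s : seq (B * P),
  a = \sum_(p <- s) act p.1 p.2.
Hypothesis proj : forall (M N : lmodType K) (aM : B -> M -> M) (aN : B -> N -> N)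
    (g : {linear M -> N}) (f : {linear P -> N}),
  module_law aM -> module_law aN ->
  equivariant aM aN g -> equivariant act aN f -> surjective g ->
  exists2 h : {linear P -> M}, equivariant act aM h & g \o h =1 f.

Let bm := law_bilinear lawm.
Let ba := actP.1.

(** The free module on the set P over the unitization B (+) K of B. *)
Let Bu : lmodType K := (B * K^o)%type.
(** An empty index type leaves no balancing relation, so [tensor] becomes the tensor product over
    K. *)
Let none (X : Type) (i : void) : X := match i with end.
Let free : lmodType K :=
  tensor (none ({malg K[P]} -> {malg K[P]})) (none (Bu -> Bu)).

(** A pair (b, k) stands for b + k 1: [uact] is left multiplication by [x] in the unitization, and
    [ev] its action on P. *)
Let uact (x : B) (q : Bu) : Bu := (m x q.1 + q.2 *: x, 0).
Let ev (q : Bu) (a : P) : P := act q.1 a + q.2 *: a.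

Let uact_bilinear : is_bilinear uact.
Proof.
split=> [q|x] k a b; rewrite /uact.
- congr pair; last by rewrite /= scaler0 addr0.
  rewrite /= (bilinearZDl bm) scalerDr scalerDr !scalerA (mulrC k).
  exact: addrACA.
- congr pair; last by rewrite /= scaler0 addr0.
  rewrite /= (bilinearZDr bm) scalerDl scalerDr -!scalerA.
  exact: addrACA.
Qed.

Let ev_bilinear : is_bilinear ev.
Proof.
split=> [a|q] k x y; rewrite /ev /=.
- rewrite (bilinearZDl ba) scalerDl scalerDr -!scalerA; exact: addrACA.
- rewrite (bilinearZDr ba) !scalerDr !scalerA (mulrC k); exact: addrACA.
Qed.

Let uact_law : module_law uact.
Proof.
split=> // x y q; rewrite /uact /= scale0r addr0; congr pair.
by rewrite [in RHS]addrC (bilinearZDr bm) (lawA lawm) addrC.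
Qed.

Let ev_uact x q a : ev (uact x q) a = act x (ev q a).
Proof.
rewrite /ev /uact /= scale0r addr0 addrC [in RHS]addrC.
by rewrite (bilinearZDl ba) (bilinearZDr ba) actP.2.
Qed.

Let aM (x : B) : free -> free := tmap id (uact x).

Let aMP x : linear (aM x) /\ forall v q, aM x (tens v q) = tens v (uact x q).
Proof.
have idl : linear (@id {malg K[P]}) by [].
apply: (@tmapP K _ _ _ _ void void (none _) (none _) (none _) (none _) id (uact x) idl
  (uact_bilinear.2 x)).
by case.
Qed.

Let aM_lin x k u v : aM x (k *: u + v) = k *: aM x u + aM x v.
Proof. exact: ((aMP x).1 k u v). Qed.

Let aM_tens x v q : aM x (tens v q) = tens v (uact x q).
Proof. exact: (aMP x).2. Qed.

Let aM_law : module_law aM.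
Proof.
have bt := @tens_bilinear K _ _ _ (none _) (none _) : is_bilinear (tens : _ -> _ -> free).
split; first split=> [t k x y|x].
- apply: (tens_ext (f := aM (k *: x + y))
    (g := fun t => k *: aM x t + aM y t)) => [|c u v /=|v q /=].
  + exact: (aMP _).1.
  + rewrite !aM_lin.
    exact: scale_add_exchange.
  + rewrite !aM_tens.
    by rewrite (uact_bilinear.1 q k x y); exact: bt.2.
- exact: (aMP x).1.
- move=> x y t; apply: (tens_ext (f := aM (m x y)) (g := aM x \o aM y)).
  + exact: (aMP _).1.
  + by move=> k u v /=; rewrite !aM_lin.
  + move=> v q /=; rewrite !aM_tens.
    by rewrite uact_law.2.
Qed.

Let eval_fun (v : {malg K[P]}) (q : Bu) : P := free_lift (ev q) v.

Let eval_bilinear : is_bilinear eval_fun.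
Proof.
split=> [q|v] k a b; first exact: free_lift_linear.
rewrite /eval_fun /free_lift scaler_sumr -big_split; apply: eq_bigr => i _ /=.
by rewrite (bilinearZDl ev_bilinear) scalerDr !scalerA mulrC.
Qed.

Let coord_bilinear i : is_bilinear (fun (v : {malg K[P]}) (q : Bu) => v@_i *: q).
Proof.
split=> [q|v] k a b; first by rewrite mcoeffD mcoeffZ scalerDl scalerA.
by rewrite scalerDr !scalerA mulrC.
Qed.

Let evalP := tliftP eval_bilinear (fun i : void => match i with end) :
  linear (tlift eval_fun : free -> P) /\ _.
Let coordP j := tliftP (coord_bilinear j) (fun i : void => match i with end) :
  linear (tlift _ : free -> Bu) /\ _.

Let eval : {linear free -> P} :=
  HB.pack (tlift eval_fun : free -> P)
    (GRing.isLinear.Build K free P *:%R (tlift eval_fun) evalP.1).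
Let coord j : {linear free -> Bu} :=
  HB.pack (tlift (fun (v : {malg K[P]}) (q : Bu) => v@_j *: q) : free -> Bu)
    (GRing.isLinear.Build K free Bu *:%R _ (coordP j).1).

Let eval_tens v q : eval (tens v q) = eval_fun v q.
Proof. exact: evalP.2. Qed.

Let coord_tens j v q : coord j (tens v q) = v@_j *: q.
Proof. exact: (coordP j).2. Qed.

Let eval_aM x t : eval (aM x t) = act x (eval t).
Proof.
apply: (tens_ext (f := fun t => eval (aM x t)) (g := fun t => act x (eval t))).
- by move=> k u v; rewrite aM_lin linearP.
- by move=> k u v; rewrite linearP (bilinearZDr ba).
- move=> v q.
  rewrite aM_tens [LHS]eval_tens [X in act x X]eval_tens /eval_fun /free_lift.
  rewrite (bilinear_sumr ba); apply: eq_bigr => i _.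
  by rewrite ev_uact (bilinearZr ba).
Qed.

Let coord_aM j x t : coord j (aM x t) = uact x (coord j t).
Proof.
apply: (tens_ext (f := fun t => coord j (aM x t))
                 (g := fun t => uact x (coord j t))).
- by move=> k u v; rewrite aM_lin linearP.
- by move=> k u v; rewrite linearP (bilinearZDr uact_bilinear).
- by move=> v q; rewrite aM_tens [LHS]coord_tens
    [coord j (tens v q)]coord_tens (bilinearZr uact_bilinear).
Qed.

Let eval_expand (L : seq free) : exists s : seq P,
  forall t, t \in L -> eval t = \sum_(i <- s) ev (coord i t) i.
Proof.
pose S := [seq p.1 | p <- flatten [seq terms t | t <- L]].
(* One finite index set for all of [L]: the supports of the first factors of all terms that
   occur. *)
pose d := [fset x in flatten [seq (msupp p : seq P) | p <- S]]%fset.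
exists d => t tL; rewrite [LHS](tlift_terms _ eval_bilinear).
under [RHS]eq_bigr => i _.
  rewrite [coord i t](tlift_terms _ (coord_bilinear i)).
  rewrite (bilinear_suml ev_bilinear).
  over.
rewrite exchange_big /=; apply: eq_big_seq => p pt.
rewrite /eval_fun (free_liftEw _ (d := d)); last first.
  apply/fsubsetP => x xp; rewrite in_fset /=; apply/flattenP.
  exists (msupp p.1 : seq P); last exact: xp.
  apply: (map_f (fun v : {malg K[P]} => (msupp v : seq P))); apply: map_f.
  by apply/flattenP; exists (terms t) => //; exact: map_f.
by apply: eq_bigr => i _; rewrite (bilinearZl ev_bilinear).
Qed.

(** Projectivity splits the evaluation map from the free module onto P; the coordinates of the
    splitting are the dual basis. *)
Lemma projective_dual_basis : dual_basis m act.
Proof.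
have ev_surj : surjective eval.
  move=> a; exists (tens << a >> (0, 1)).
  rewrite eval_tens /eval_fun free_lift_gen /ev /= (bilinear0l ba) add0r.
  exact: scale1r.
have [h hM hK] := @proj free P aM act eval idfun aM_law actP
  eval_aM (fun _ _ => erefl) ev_surj.
(* The coordinates lie in B and not merely in its unitization, because P = BP and B times the
   unitization is contained in B. *)
have coord2 i a : (coord i (h a)).2 = 0.
  pose c2 : {linear P -> K^o} := snd \o coord i \o h.
  have [s ->] := act_full a; rewrite -[LHS]/(c2 _) linear_sum.
  apply: big1_seq => p _; rewrite [LHS]/((coord i (h _)).2).
  by rewrite hM coord_aM.
pose f i : {linear P -> B} := fst \o coord i \o h.
exists f; split=> [i x a|L].
  rewrite [LHS]/((coord i (h _)).1) hM coord_aM.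
  rewrite [LHS]/(m x (coord i (h a)).1 + (coord i (h a)).2 *: x).
  by rewrite coord2 scale0r; exact: addr0.
have [s sE] := eval_expand [seq h a | a <- L].
exists s => a aL; apply: (etrans (esym (hK a))).
apply: (etrans (sE _ (map_f h aL))); apply: eq_bigr => i _.
by rewrite /ev coord2 scale0r; exact: addr0.
Qed.

End DualBasis.

(** * The two sides of a regular multiplier Hopf algebroid *)

Lemma nondegenerate_r (K : fieldType) (A : nuAlgType K) : Defs.nondegenerate A ->
  forall a : A, (forall b, a ** b = 0) -> a = 0.
Proof.
move=> nd a h; case: (eqVneq a 0) => // /nd[[b]].
by rewrite h eqxx.
Qed.

Lemma nondegenerate_l (K : fieldType) (A : nuAlgType K) : Defs.nondegenerate A ->
  forall a : A, (forall b, b ** a = 0) -> a = 0.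
Proof.
move=> nd a h; case: (eqVneq a 0) => // /nd[_ [b]].
by rewrite h eqxx.
Qed.

Lemma nmul_law (K : fieldType) (A : nuAlgType K) : algebra_law (@nmul K A).
Proof. by split; [exact: nmul_bilinear | exact: nmulA]. Qed.

Lemma faithful_r (K : fieldType) (D : nuAlgType K) (w : {scalar D}) :
  faithful w -> forall d : D, (forall d', w (d ** d') = 0) -> d = 0.
Proof.
move=> fw d h; case: (eqVneq d 0) => // /fw[[d']].
by rewrite h eqxx.
Qed.

Lemma faithful_l (K : fieldType) (D : nuAlgType K) (w : {scalar D}) :
  faithful w -> forall d : D, (forall d', w (d' ** d) = 0) -> d = 0.
Proof.
move=> fw d h; case: (eqVneq d 0) => // /fw[_ [d']].
by rewrite h eqxx.
Qed.

Section MultiplierActions.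
Context (K : fieldType) (A D : nuAlgType K) (i : {linear D -> multiplier A}).
Hypothesis ndA : Defs.nondegenerate A.
Hypothesis i_inj : injective i.
Hypothesis iM : forall x x', i (x ** x') = i x ** i x'.

Lemma mulL_bilinear : is_bilinear (fun x a => mulL (i x) a).
Proof.
split=> [a|x] k x1 x2; last exact: mulL_linear.
by rewrite linearP; exact: mulL_ZD.
Qed.

Lemma mulR_bilinear : is_bilinear (fun x a => mulR (i x) a).
Proof.
split=> [a|x] k x1 x2; last exact: mulR_linear.
by rewrite linearP; exact: mulR_ZD.
Qed.

Lemma mulL_comp x x' a : mulL (i (x ** x')) a = mulL (i x) (mulL (i x') a).
Proof. by rewrite iM. Qed.

Lemma mulR_comp x x' a : mulR (i (x' ** x)) a = mulR (i x) (mulR (i x') a).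
Proof. by rewrite iM. Qed.

Lemma mulL_faithful x : (forall a, mulL (i x) a = 0) -> x = 0.
Proof.
move=> h; apply: i_inj; rewrite linear0; apply: multiplierP => a.
  by rewrite h.
apply: (nondegenerate_r ndA) => b.
by rewrite mulRL h nmul0r.
Qed.

Lemma mulR_faithful x : (forall a, mulR (i x) a = 0) -> x = 0.
Proof.
move=> h; apply: i_inj; rewrite linear0; apply: multiplierP => a; last first.
  by rewrite h.
apply: (nondegenerate_l ndA) => b.
by rewrite -mulRL h nmul0l.
Qed.

End MultiplierActions.

(** * Actions of the base algebras on the total algebra *)

Section Graph.
Context (K : fieldType) (Q : quantum_graphs K).
Notation A := (tot Q).
Notation B := (bB Q).
Notation C := (bC Q).

Lemma lB_bilinear : is_bilinear (@lB K Q). Proof. exact: mulL_bilinear. Qed.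
Lemma rB_bilinear : is_bilinear (@rB K Q). Proof. exact: mulR_bilinear. Qed.
Lemma lC_bilinear : is_bilinear (@lC K Q). Proof. exact: mulL_bilinear. Qed.
Lemma rC_bilinear : is_bilinear (@rC K Q). Proof. exact: mulR_bilinear. Qed.

Lemma lC_comp y y' (a : A) : lC (y ** y') a = lC y (lC y' a).
Proof. by apply: mulL_comp; exact: iCM. Qed.

Lemma lB_comp x x' (a : A) : lB (x ** x') a = lB x (lB x' a).
Proof. by apply: mulL_comp; exact: iBM. Qed.

Lemma rC_comp y y' (a : A) : rC (y' ** y) a = rC y (rC y' a).
Proof. by apply: mulR_comp; exact: iCM. Qed.

Lemma rB_comp x x' (a : A) : rB (x' ** x) a = rB x (rB x' a).
Proof. by apply: mulR_comp; exact: iBM. Qed.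

Lemma lB_lC x y (a : A) : lB x (lC y a) = lC y (lB x a).
Proof. by have := congr1 (fun T => mulL T a) (iBC_comm x y). Qed.

Lemma rB_rC x y (a : A) : rB x (rC y a) = rC y (rB x a).
Proof. by have := congr1 (fun T => mulR T a) (iBC_comm x y). Qed.

(** After multiplication by [b] on the right, both sides are (s a)(t b); non-degeneracy removes
    [b]. *)
Lemma mulL_mulR (s t : multiplier A) a : mulL s (mulR t a) = mulR t (mulL s a).
Proof.
apply/eqP; rewrite -subr_eq0; apply/eqP.
apply: (nondegenerate_r (@tot_nondegenerate K Q)) => b.
rewrite nmulDl -scaleN1r nmulZl.
by rewrite -mulLM mulRL -[X in _ + _ *: X]/(_ ** _) mulRL mulLM scaleN1r subrr.
Qed.

Lemma rB_lB x x' (a : A) : rB x (lB x' a) = lB x' (rB x a).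
Proof. exact/esym/mulL_mulR. Qed.

Lemma rB_lC x y (a : A) : rB x (lC y a) = lC y (rB x a).
Proof. exact/esym/mulL_mulR. Qed.

Lemma rC_lB y x (a : A) : rC y (lB x a) = lB x (rC y a).
Proof. exact/esym/mulL_mulR. Qed.

Lemma rC_lC y y' (a : A) : rC y (lC y' a) = lC y' (rC y a).
Proof. exact/esym/mulL_mulR. Qed.

(** Since BA = CA = AB = AC = A, the elements x y a x' y' span A. This reduces the relations for a
    single base element to the given one with four. *)
Lemma base_ext (V : lmodType K) (f g : A -> V) : linear f -> linear g ->
  (forall x y x' y' a, f (lB x (lC y (rB x' (rC y' a)))) =
                       g (lB x (lC y (rB x' (rC y' a))))) -> f =1 g.
Proof.
move=> lf lg h.
have span (X : Type) (T : X -> A -> A) (u : A -> A) : linear u ->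
    (forall a, exists s : seq (X * A), a = \sum_(p <- s) T p.1 p.2) ->
    (forall x a, f (u (T x a)) = g (u (T x a))) -> forall a, f (u a) = g (u a).
  move=> lu full hT b; have [s ->] := full b.
  rewrite (linear_sum_seq lu) (linear_sum_seq lf) (linear_sum_seq lg).
  by apply: eq_bigr => p _.
apply: (span _ (@lB K Q) id) => //; first exact: BA_full.
move=> x; apply: (span _ (@lC K Q) (@lB K Q x)); first exact: lB_bilinear.2.
  exact: CA_full.
move=> y; apply: (span _ (@rB K Q) (fun a => lB x (lC y a))).
- by move=> k u v; rewrite (lC_bilinear.2 y) (lB_bilinear.2 x).
- exact: AB_full.
move=> x'; apply: (span _ (@rC K Q) (fun a => lB x (lC y (rB x' a)))).
- by move=> k u v; rewrite (rB_bilinear.2 x') (lC_bilinear.2 y) (lB_bilinear.2 x).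
- exact: AC_full.
by move=> y' a.
Qed.

Lemma SBinv_is_linear : linear (@SBinv K Q).
Proof.
move=> k x y; apply: (can_inj (@SBK K Q)).
by rewrite linearP !SBinvK.
Qed.

Lemma SCinv_is_linear : linear (@SCinv K Q).
Proof.
move=> k x y; apply: (can_inj (@SCK K Q)).
by rewrite linearP !SCinvK.
Qed.

Definition SBinv_lin : {linear C -> B} :=
  HB.pack (@SBinv K Q) (GRing.isLinear.Build K C B *:%R _ SBinv_is_linear).
Definition SCinv_lin : {linear B -> C} :=
  HB.pack (@SCinv K Q) (GRing.isLinear.Build K B C *:%R _ SCinv_is_linear).

Lemma SCinv_antimul x x' : SCinv (x ** x') = SCinv x' ** SCinv x :> C.
Proof. by apply: (can_inj (@SCK K Q)); rewrite SC_antimul !SCinvK. Qed.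

End Graph.

(** * The comultiplications evaluated on balanced maps *)

Section Bialgebroid.
Context (K : fieldType) (H : multiplier_bialgebroid K).
Notation A := (tot H).
Notation B := (bB H).
Notation C := (bC H).
Context (epsB : {linear A -> B}) (epsC : {linear A -> C}).
Context (muB : {scalar B}) (muC : {scalar C}).

Definition left_side : side A B C :=
  Side (@lB K H) (@lC K H) (SB H) (SBinv_lin H) epsB
    (fun a b => terms (DeltaB1l a b)) (fun a b => terms (DeltaB1r a b)).

(** The counit of the right side is S_C o eps_C, with values in B. *)
Definition right_side : side A B C :=
  Side (@rB K H) (@rC K H) (SCinv_lin H) (SC H) (SC H \o epsC)
    (fun a b => terms (DeltaC1l b a)) (fun a b => terms (DeltaC1r b a)).

Lemma bal_left (V : lmodType K) (F : A -> A -> V) :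
  bal left_side F -> balanced (@lB K H) (@lSB K H) F.
Proof. by []. Qed.

Lemma bal_right (V : lmodType K) (F : A -> A -> V) :
  bal right_side F -> balanced (@rSC K H) (@rC K H) F.
Proof.
case=> bF hF; split=> // y u v; rewrite /rSC.
by have := hF (SC H y) u v => /= ->; rewrite SCK.
Qed.

Lemma commute_tens (I : Type) (r l : I -> A -> A) (f g : A -> A) :
  (forall i a, f (r i a) = r i (f a)) -> (forall i a, g (l i a) = l i (g a)) ->
  forall i m n, tens (f (r i m)) (g n) = tens (f m) (g (l i n)) :> tensor r l.
Proof. by move=> hf hg i m n; rewrite hf hg tens_balanced. Qed.

Lemma tlift_comp (I : Type) (r l : I -> A -> A) (f g : A -> A) :
  linear f -> linear g ->
  (forall i a, f (r i a) = r i (f a)) -> (forall i a, g (l i a) = l i (g a)) ->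
  forall (V : lmodType K) (F : A -> A -> V) (t : tensor r l),
  balanced r l F ->
  tlift F (tmap f g t : tensor r l) = sw (terms t) (fun u v => F (f u) (g v)).
Proof.
move=> lf lg hf hg V F t [bF hF].
rewrite (tlift_tmap lf lg (commute_tens hf hg) _ bF hF) tlift_terms //.
by split=> [v|u] k a b; rewrite ?lf ?lg (bilinearZDl bF, bilinearZDr bF).
Qed.

Lemma tmap_comp_tens (I : Type) (r l : I -> A -> A) (f g : A -> A) :
  linear f -> linear g ->
  (forall i a, f (r i a) = r i (f a)) -> (forall i a, g (l i a) = l i (g a)) ->
  forall u v, tmap f g (tens u v : tensor r l) = tens (f u) (g v) :> tensor r l.
Proof. by move=> lf lg hf hg; exact: (tmapP lf lg (commute_tens hf hg)).2. Qed.

Let mull_lin (c : A) : linear (nmul c).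
Proof. exact: (@nmul_bilinear K A).2. Qed.
Let mulr_lin (c : A) : linear (nmul^~ c).
Proof. exact: (@nmul_bilinear K A).1. Qed.
Let id_lin : linear (@id A).
Proof. by []. Qed.

(** A covered sum over chosen terms is [F] evaluated at Delta_B(a)(b (x) c), hence independent of
    the choice. The analogue for [dr] has the same value, which relates [dl] and [dr]. *)
Lemma DeltaB_dl (V : lmodType K) (F : A -> A -> V) a b c : bal left_side F ->
  sw (dl left_side a b) (fun u v => F u (v ** c)) =
  tlift F (DeltaB a (tens b c)).
Proof.
move=> bF; rewrite DeltaB1lP (tlift_comp id_lin (mulr_lin c)) // => i v.
by rewrite /lSB /lC mulLM.
Qed.

Lemma DeltaB_dr (V : lmodType K) (F : A -> A -> V) a b c : bal left_side F ->
  sw (dr left_side a c) (fun u v => F (u ** b) v) =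
  tlift F (DeltaB a (tens b c)).
Proof.
move=> bF; rewrite DeltaB1rP (tlift_comp (mulr_lin b) id_lin) // => i v.
by rewrite /lB mulLM.
Qed.

Lemma DeltaC_dl (V : lmodType K) (F : A -> A -> V) a b c : bal right_side F ->
  sw (dl right_side a b) (fun u v => F u (c ** v)) =
  tlift F (DeltaC a (tens b c)).
Proof.
move=> /bal_right bF.
rewrite DeltaC1lP (tlift_comp id_lin (mull_lin c)) // => i v.
by rewrite /rC mulRM.
Qed.

Lemma DeltaC_dr (V : lmodType K) (F : A -> A -> V) a b c : bal right_side F ->
  sw (dr right_side a c) (fun u v => F (b ** u) v) =
  tlift F (DeltaC a (tens b c)).
Proof.
move=> /bal_right bF.
rewrite DeltaC1rP (tlift_comp (mull_lin b) id_lin) // => i v.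
by rewrite /rSC /rB mulRM.
Qed.

Lemma DeltaB_lin_ev (V : lmodType K) (F : A -> A -> V) k a a' t :
  bal left_side F ->
  tlift F (DeltaB (k *: a + a') t) = k *: tlift F (DeltaB a t) + tlift F (DeltaB a' t).
Proof.
by move=> bF; have [lF _] := tliftP bF.1 bF.2; rewrite DeltaB_linear; exact: lF.
Qed.

Lemma DeltaC_lin_ev (V : lmodType K) (F : A -> A -> V) k a a' t :
  bal right_side F ->
  tlift F (DeltaC (k *: a + a') t) = k *: tlift F (DeltaC a t) + tlift F (DeltaC a' t).
Proof.
move=> /bal_right bF; have [lF _] := tliftP bF.1 bF.2.
by rewrite DeltaC_linear; exact: lF.
Qed.

Lemma DeltaB_base_ev (V : lmodType K) (F : A -> A -> V) x x' y y' a b c :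
  bal left_side F ->
  tlift F (DeltaB (lB x (lC y (rB x' (rC y' a)))) (tens b c)) =
  tlift (fun u v => F (lC y u) (lB x v)) (DeltaB a (tens (lC y' b) (lB x' c))).
Proof.
move=> bF.
have cC z i a0 : lC z (lB i a0) = lB i (lC z a0) :> A by rewrite lB_lC.
have cB z i a0 : lB z (lSB i a0) = lSB i (lB z a0) :> A by rewrite /lSB lB_lC.
rewrite DeltaB_base tmap_comp_tens //; try exact: (lC_bilinear H).2;
  try exact: (lB_bilinear H).2.
rewrite (tlift_comp ((lC_bilinear H).2 y) ((lB_bilinear H).2 x)) //.
rewrite tlift_terms //; split=> [v|u] k u1 u2.
- by rewrite (bilinearZDr (lC_bilinear H)) (bilinearZDl bF.1).
- by rewrite (bilinearZDr (lB_bilinear H)) (bilinearZDr bF.1).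
Qed.

Lemma DeltaC_base_ev (V : lmodType K) (F : A -> A -> V) x x' y y' a b c :
  bal right_side F ->
  tlift F (DeltaC (lB x (lC y (rB x' (rC y' a)))) (tens b c)) =
  tlift (fun u v => F (rC y' u) (rB x' v)) (DeltaC a (tens (rC y b) (rB x c))).
Proof.
move=> /bal_right bF.
have cC z i a0 : rC z (rSC i a0) = rSC i (rC z a0) :> A by rewrite /rSC rB_rC.
have cB z i a0 : rB z (rC i a0) = rC i (rB z a0) :> A by rewrite rB_rC.
rewrite DeltaC_base tmap_comp_tens //; try exact: (rC_bilinear H).2;
  try exact: (rB_bilinear H).2.
rewrite (tlift_comp ((rC_bilinear H).2 y') ((rB_bilinear H).2 x')) //.
rewrite tlift_terms //; split=> [v|u] k u1 u2.
- by rewrite (bilinearZDr (rC_bilinear H)) (bilinearZDl bF.1).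
- by rewrite (bilinearZDr (rB_bilinear H)) (bilinearZDr bF.1).
Qed.

Lemma bal_lC (V : lmodType K) (F : A -> A -> V) y : bal left_side F ->
  bal left_side (fun u v => F (lC y u) v).
Proof.
move=> bF; split; first split=> [v|u] k u1 u2.
- by rewrite (bilinearZDr (lC_bilinear H)) (bilinearZDl bF.1).
- by rewrite (bilinearZDr bF.1).
- by move=> x u v /=; rewrite -lB_lC; exact: bF.2.
Qed.

Lemma bal_lB (V : lmodType K) (F : A -> A -> V) x : bal left_side F ->
  bal left_side (fun u v => F u (lB x v)).
Proof.
move=> bF; split; first split=> [v|u] k u1 u2.
- by rewrite (bilinearZDl bF.1).
- by rewrite (bilinearZDr (lB_bilinear H)) (bilinearZDr bF.1).
- by move=> x' u v /=; rewrite lB_lC; exact: bF.2.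
Qed.

Section BaseLeft.
Context (V : lmodType K) (F : A -> A -> V) (bF : bal left_side F).

Let ev_linear b c (u : A -> A) : linear u ->
  linear (fun a => tlift F (DeltaB (u a) (tens b c))).
Proof. by move=> lu k x y; rewrite lu DeltaB_lin_ev. Qed.

Lemma DeltaB_lC y a b c : tlift F (DeltaB (lC y a) (tens b c)) =
  tlift (fun u v => F (lC y u) v) (DeltaB a (tens b c)).
Proof.
have bG := bal_lC y bF.
move: a; apply: base_ext; first exact: (ev_linear _ _ ((lC_bilinear H).2 y)).
  by move=> k a a'; rewrite DeltaB_lin_ev.
move=> x0 y0 x0' y0' a; rewrite -lB_lC -lC_comp
  (DeltaB_base_ev _ _ _ _ _ _ _ bF) (DeltaB_base_ev _ _ _ _ _ _ _ bG).
by apply: eq_tlift => u v; rewrite lC_comp.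
Qed.

Lemma DeltaB_lB x a b c : tlift F (DeltaB (lB x a) (tens b c)) =
  tlift (fun u v => F u (lB x v)) (DeltaB a (tens b c)).
Proof.
have bG := bal_lB x bF.
move: a; apply: base_ext; first exact: (ev_linear _ _ ((lB_bilinear H).2 x)).
  by move=> k a a'; rewrite DeltaB_lin_ev.
move=> x0 y0 x0' y0' a; rewrite -lB_comp
  (DeltaB_base_ev _ _ _ _ _ _ _ bF) (DeltaB_base_ev _ _ _ _ _ _ _ bG).
by apply: eq_tlift => u v; rewrite lB_comp.
Qed.

Lemma DeltaB_rC y a b c : tlift F (DeltaB (rC y a) (tens b c)) =
  tlift F (DeltaB a (tens (lC y b) c)).
Proof.
move: a; apply: base_ext; first exact: (ev_linear _ _ ((rC_bilinear H).2 y)).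
  by move=> k a a'; rewrite DeltaB_lin_ev.
move=> x0 y0 x0' y0' a.
have -> : rC y (lB x0 (lC y0 (rB x0' (rC y0' a)))) =
    lB x0 (lC y0 (rB x0' (rC (y0' ** y) a))).
  by rewrite rC_lB rC_lC -rB_rC rC_comp.
by rewrite !(DeltaB_base_ev _ _ _ _ _ _ _ bF) lC_comp.
Qed.

Lemma DeltaB_rB x a b c : tlift F (DeltaB (rB x a) (tens b c)) =
  tlift F (DeltaB a (tens b (lB x c))).
Proof.
move: a; apply: base_ext; first exact: (ev_linear _ _ ((rB_bilinear H).2 x)).
  by move=> k a a'; rewrite DeltaB_lin_ev.
move=> x0 y0 x0' y0' a.
have -> : rB x (lB x0 (lC y0 (rB x0' (rC y0' a)))) =
    lB x0 (lC y0 (rB (x0' ** x) (rC y0' a))).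
  by rewrite rB_lB rB_lC rB_comp.
by rewrite !(DeltaB_base_ev _ _ _ _ _ _ _ bF) lB_comp.
Qed.

End BaseLeft.

Lemma bal_rC (V : lmodType K) (F : A -> A -> V) y : bal right_side F ->
  bal right_side (fun u v => F (rC y u) v).
Proof.
move=> bF; split; first split=> [v|u] k u1 u2.
- by rewrite (bilinearZDr (rC_bilinear H)) (bilinearZDl bF.1).
- by rewrite (bilinearZDr bF.1).
- by move=> x u v /=; rewrite -rB_rC; exact: bF.2.
Qed.

Lemma bal_rB (V : lmodType K) (F : A -> A -> V) x : bal right_side F ->
  bal right_side (fun u v => F u (rB x v)).
Proof.
move=> bF; split; first split=> [v|u] k u1 u2.
- by rewrite (bilinearZDl bF.1).
- by rewrite (bilinearZDr (rB_bilinear H)) (bilinearZDr bF.1).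
- by move=> x' u v /=; rewrite rB_rC; exact: bF.2.
Qed.

Section BaseRight.
Context (V : lmodType K) (F : A -> A -> V) (bF : bal right_side F).

Let ev_linear b c (u : A -> A) : linear u ->
  linear (fun a => tlift F (DeltaC (u a) (tens b c))).
Proof. by move=> lu k x y; rewrite lu DeltaC_lin_ev. Qed.

Lemma DeltaC_rC y a b c : tlift F (DeltaC (rC y a) (tens b c)) =
  tlift (fun u v => F (rC y u) v) (DeltaC a (tens b c)).
Proof.
have bG := bal_rC y bF.
move: a; apply: base_ext; first exact: (ev_linear _ _ ((rC_bilinear H).2 y)).
  by move=> k a a'; rewrite DeltaC_lin_ev.
move=> x0 y0 x0' y0' a.
have -> : rC y (lB x0 (lC y0 (rB x0' (rC y0' a)))) =
    lB x0 (lC y0 (rB x0' (rC (y0' ** y) a))).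
  by rewrite rC_lB rC_lC -rB_rC rC_comp.
rewrite (DeltaC_base_ev _ _ _ _ _ _ _ bF) (DeltaC_base_ev _ _ _ _ _ _ _ bG).
by apply: eq_tlift => u v; rewrite rC_comp.
Qed.

Lemma DeltaC_rB x a b c : tlift F (DeltaC (rB x a) (tens b c)) =
  tlift (fun u v => F u (rB x v)) (DeltaC a (tens b c)).
Proof.
have bG := bal_rB x bF.
move: a; apply: base_ext; first exact: (ev_linear _ _ ((rB_bilinear H).2 x)).
  by move=> k a a'; rewrite DeltaC_lin_ev.
move=> x0 y0 x0' y0' a.
have -> : rB x (lB x0 (lC y0 (rB x0' (rC y0' a)))) =
    lB x0 (lC y0 (rB (x0' ** x) (rC y0' a))).
  by rewrite rB_lB rB_lC rB_comp.
rewrite (DeltaC_base_ev _ _ _ _ _ _ _ bF) (DeltaC_base_ev _ _ _ _ _ _ _ bG).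
by apply: eq_tlift => u v; rewrite rB_comp.
Qed.

Lemma DeltaC_lC y a b c : tlift F (DeltaC (lC y a) (tens b c)) =
  tlift F (DeltaC a (tens (rC y b) c)).
Proof.
move: a; apply: base_ext; first exact: (ev_linear _ _ ((lC_bilinear H).2 y)).
  by move=> k a a'; rewrite DeltaC_lin_ev.
by move=> x0 y0 x0' y0' a; rewrite -lB_lC -lC_comp
  !(DeltaC_base_ev _ _ _ _ _ _ _ bF) rC_comp.
Qed.

Lemma DeltaC_lB x a b c : tlift F (DeltaC (lB x a) (tens b c)) =
  tlift F (DeltaC a (tens b (rB x c))).
Proof.
move: a; apply: base_ext; first exact: (ev_linear _ _ ((lB_bilinear H).2 x)).
  by move=> k a a'; rewrite DeltaC_lin_ev.
by move=> x0 y0 x0' y0' a; rewrite -lB_comp !(DeltaC_base_ev _ _ _ _ _ _ _ bF) rB_comp.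
Qed.

End BaseRight.

End Bialgebroid.

Section ProjectiveActions.
Context (K : fieldType) (A : lmodType K).

Lemma left_dual_basis (D : nuAlgType K) (act : D -> A -> A) :
  is_bilinear act -> (forall x y a, act (x ** y) a = act x (act y a)) ->
  (forall a, exists s : seq (D * A), a = \sum_(p <- s) act p.1 p.2) ->
  left_projective act -> dual_basis (@nmul K D) act.
Proof.
move=> ba ca full proj.
by apply: (projective_dual_basis (nmul_law D)).
Qed.

Lemma right_dual_basis (D : nuAlgType K) (act : D -> A -> A) :
  is_bilinear act -> (forall x y a, act (y ** x) a = act x (act y a)) ->
  (forall a, exists s : seq (D * A), a = \sum_(p <- s) act p.1 p.2) ->
  right_projective act -> dual_basis (fun x y : D => y ** x) act.
Proof.
move=> ba ca full proj.
apply: (projective_dual_basis (algebra_law_op (nmul_law D))) => //.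
move=> M N aM aN g f [bM cM] [bN cN].
by apply: proj; split.
Qed.

End ProjectiveActions.

(** * Both sides satisfy the axioms *)

Section SideAxioms.
Context (K : fieldType) (H : regular_multiplier_Hopf_algebroid K).
Notation A := (tot H).
Notation B := (bB H).
Notation C := (bC H).
Context (epsB : {linear A -> B}) (epsC : {linear A -> C}).
Context (muB : {scalar B}) (muC : {scalar C}).
Hypothesis epsBP : left_counit epsB.
Hypothesis epsCP : right_counit epsC.
Hypothesis projH : projective H.
Hypothesis mu : base_weight epsB epsC muB muC.

Let Lside := left_side epsB.
Let Rside := right_side epsC.

Lemma tlift_sw (I : Type) (r l : I -> A -> A) (V : lmodType K)
    (F : A -> A -> V) (G : A -> A -> tensor r l) s :
  balanced r l F ->
  tlift F (sw s G) = sw s (fun u v => tlift F (G u v)).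
Proof. by case=> bF hF; rewrite (sw_linear _ _ (tliftP bF hF).1). Qed.

Lemma left_side_axioms :
  side_axioms (@nmul K A) (@nmul K B) (@nmul K C) muB muC Lside Rside.
Proof.
have [pB _ pC _] := projH.
split.
- exact: nmul_law.
- exact: nmul_law.
- exact: nmul_law.
- exact: (nondegenerate_r (@tot_nondegenerate K H)).
- exact: (faithful_r (muB_faithful mu)).
- exact: (faithful_r (muC_faithful mu)).
- exact: (muC_SB mu).
- exact: lB_bilinear.
- exact: lC_bilinear.
- by move=> x a b; exact: mulLM.
- by move=> y a b; exact: mulLM.
- by move=> x a b; rewrite -[RHS]/(mulR _ a ** b) mulRL.
- by move=> x a b; rewrite -[RHS]/(mulR _ a ** b) mulRL.
- exact: lB_comp.
- exact: lC_comp.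
- exact: lB_lC.
- by apply: mulL_faithful; [exact: tot_nondegenerate|exact: iB_inj].
- by apply: mulL_faithful; [exact: tot_nondegenerate|exact: iC_inj].
- exact: SBK.
- exact: SBinvK.
- exact: SB_antimul.
- by apply: left_dual_basis;
    [exact: lB_bilinear|exact: lB_comp|exact: BA_full|exact: pB].
- by apply: left_dual_basis;
    [exact: lC_bilinear|exact: lC_comp|exact: CA_full|exact: pC].
- exact: (left_counit_lB epsBP).
- exact: (left_counit_lSB epsBP).
- move=> a b; rewrite -[RHS](left_counit_id1 epsBP) tlift_terms //.
  split=> [v|u] k x y; last by rewrite (lC_bilinear H).2.
  by rewrite !linearP (bilinearZDl (lC_bilinear H)).
- move=> a b; rewrite -[RHS](left_counit_id2 epsBP) tlift_terms //.
  split=> [v|u] k x y; first by rewrite (lB_bilinear H).2.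
  by rewrite linearP (bilinearZDl (lB_bilinear H)).
- by move=> V F a b c bF; rewrite (DeltaB_dr _ _ _ bF) (DeltaB_dl _ _ _ bF).
- move=> V F k a a' b c bF; rewrite !(DeltaB_dl _ _ _ bF).
  exact: (DeltaB_lin_ev _ _ _ _ bF).
- move=> V F x a b c bF; rewrite !(DeltaB_dl _ _ _ bF) -[bact _ x b]/(lB x b).
  by rewrite tens_balanced.
- move=> V F a a' b c bF; rewrite (DeltaB_dl _ _ _ bF) DeltaB_mul DeltaB1lP.
  under [RHS]eq_sw => u v do rewrite (DeltaB_dl _ _ _ bF).
  (* Both sides are now [tlift F] of Delta_B(a) applied to Delta_B(a')(b (x) c), the latter written
     once through [tmap] and once through its terms. *)
  rewrite -(tlift_sw _ _ bF) -(sw_linear _ _ (@linearP _ _ _ _ (DeltaB a))).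
  congr (tlift F (DeltaB a _)).
  rewrite /tmap tlift_terms //; split=> [v|u] k x y.
    by rewrite (bilinearZDl (tens_bilinear _ _)).
  by rewrite nmulZDl (bilinearZDr (tens_bilinear _ _)).
- move=> V F y a b c bF; rewrite (DeltaB_dl _ _ _ bF) (DeltaB_lC bF).
  by rewrite -(DeltaB_dl _ _ _ (bal_lC y bF)).
- move=> V F x a b c bF; rewrite (DeltaB_dl _ _ _ bF) (DeltaB_lB bF).
  by rewrite -(DeltaB_dl _ _ _ (bal_lB x bF)).
- by move=> V F y a b c bF; rewrite !(DeltaB_dl _ _ _ bF) (DeltaB_rC bF).
- by move=> V F x a b c bF; rewrite !(DeltaB_dl _ _ _ bF) (DeltaB_rB bF).
Qed.

Lemma right_side_axioms :
  side_axioms (fun a b : A => b ** a) (fun x x' : B => x' ** x)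
    (fun y y' : C => y' ** y) muB muC Rside Lside.
Proof.
have [_ pB _ pC] := projH.
split.
- exact/algebra_law_op/nmul_law.
- exact/algebra_law_op/nmul_law.
- exact/algebra_law_op/nmul_law.
- exact: (nondegenerate_l (@tot_nondegenerate K H)).
- exact: (faithful_l (muB_faithful mu)).
- exact: (faithful_l (muC_faithful mu)).
- by move=> x; rewrite -(muB_SC mu) SCinvK.
- exact: rB_bilinear.
- exact: rC_bilinear.
- by move=> x a b; exact: mulRM.
- by move=> y a b; exact: mulRM.
- by move=> x a b; exact: mulRL.
- by move=> x a b; exact: mulRL.
- by move=> x x' a; exact: rB_comp.
- by move=> y y' a; exact: rC_comp.
- exact: rB_rC.
- by apply: mulR_faithful; [exact: tot_nondegenerate|exact: iB_inj].
- by apply: mulR_faithful; [exact: tot_nondegenerate|exact: iC_inj].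
- exact: SCinvK.
- exact: SCK.
- by move=> x x'; exact: SCinv_antimul.
- by apply: right_dual_basis;
    [exact: rB_bilinear|by move=> *; exact: rB_comp|exact: AB_full|exact: pB].
- by apply: right_dual_basis;
    [exact: rC_bilinear|by move=> *; exact: rC_comp|exact: AC_full|exact: pC].
- move=> x a; rewrite -{1}[x](@SCinvK K H) -[bact _ _ a]/(rSC (SCinv x) a).
  by rewrite /= (right_counit_rSC epsCP) SC_antimul SCinvK.
- by move=> x a; rewrite /= (right_counit_rC epsCP) SC_antimul SCinvK.
- move=> a b; rewrite -[RHS](right_counit_id1 epsCP) tlift_terms.
    by apply: eq_bigr => p _; rewrite /= SCK.
  split=> [v|u] k x y; last by rewrite (rC_bilinear H).2.
  by rewrite linearP (bilinearZDl (rC_bilinear H)).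
- move=> a b; rewrite -[RHS](right_counit_id2 epsCP) tlift_terms //.
  split=> [v|u] k x y; first by rewrite (rB_bilinear H).2.
  by rewrite !linearP (bilinearZDl (rB_bilinear H)).
- by move=> V F a b c bF; rewrite (DeltaC_dr _ _ _ bF) (DeltaC_dl _ _ _ bF).
- move=> V F k a a' b c bF; rewrite !(DeltaC_dl _ _ _ bF).
  exact: (DeltaC_lin_ev _ _ _ _ bF).
- move=> V F x a b c bF; rewrite !(DeltaC_dl _ _ _ bF).
  have -> : bact Rside x b = rSC (SCinv x) b by rewrite /rSC SCinvK.
  by rewrite tens_balanced.
- move=> V F a a' b c bF; rewrite (DeltaC_dl _ _ _ bF) DeltaC_mul DeltaC1lP.
  under [RHS]eq_sw => u v do rewrite (DeltaC_dl _ _ _ bF).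
  rewrite -(tlift_sw _ _ (bal_right bF)).
  rewrite -(sw_linear _ _ (@linearP _ _ _ _ (DeltaC a))).
  congr (tlift F (DeltaC a _)).
  rewrite /tmap tlift_terms //; split=> [v|u] k x y.
    by rewrite (bilinearZDl (tens_bilinear _ _)).
  by rewrite nmulZDr (bilinearZDr (tens_bilinear _ _)).
- move=> V F y a b c bF; rewrite (DeltaC_dl _ _ _ bF) (DeltaC_rC bF).
  by rewrite -(DeltaC_dl _ _ _ (bal_rC y bF)).
- move=> V F x a b c bF; rewrite (DeltaC_dl _ _ _ bF) (DeltaC_rB bF).
  by rewrite -(DeltaC_dl _ _ _ (bal_rB x bF)).
- by move=> V F y a b c bF; rewrite !(DeltaC_dl _ _ _ bF) (DeltaC_lC bF).
- by move=> V F x a b c bF; rewrite !(DeltaC_dl _ _ _ bF) (DeltaC_lB bF).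
Qed.

End SideAxioms.

(** * Faithfulness for abstract sides *)

Section FaithfulIntegral.
Context (K : fieldType) (A B C : lmodType K).
Context (mA : A -> A -> A) (mB : B -> B -> B) (mC : C -> C -> C).
Context (muB : {scalar B}) (muC : {scalar C}) (l r : side A B C).
Hypothesis ax : hopf_axioms mA mB mC muB muC l r.
Hypothesis surj_r : canonical_surj r.
Hypothesis inj_r : canonical_inj l r.
Hypothesis surj_l : canonical_surj l.
Hypothesis inj_l : canonical_inj r l.
Context (phi : {scalar A}) (Bphi phiB : A -> B) (Cphi phiC : A -> C).
Hypothesis BphiP : forall x a, phi (bact l x a) = muB (mB x (Bphi a)).
Hypothesis phiBP : forall x a, phi (bact r x a) = muB (mB (phiB a) x).
Hypothesis CphiP : forall y a, phi (cact l y a) = muC (mC y (Cphi a)).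
Hypothesis phiCP : forall y a, phi (cact r y a) = muC (mC (phiC a) y).
Hypothesis inv : forall a b,
  sw (dl l b a) (fun u v => bact l (antV l (Cphi v)) u) = cact l (Cphi b) a.
Hypotheses (Bphi_surj : surjective Bphi) (phiB_surj : surjective phiB).

(** The second half is the first for the opposite algebra, where the sides change places and the
    invariance takes the form required by [slice_null2]. *)
Lemma faithful_integral :
  (forall a, (forall b, phi (mA b a) = 0) -> a = 0) /\
  (forall a, (forall b, phi (mA a b) = 0) -> a = 0).
Proof.
split.
- apply: (null_eq0 ax surj_r inj_r phiBP phiCP phiB_surj).
  exact: (slice_null1 ax surj_r CphiP phiCP inv).
- have axo := hopf_axioms_op ax.
  apply: (null_eq0 axo surj_l inj_l BphiP CphiP Bphi_surj).
  exact: (slice_null2 axo surj_l CphiP inv).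
Qed.

End FaithfulIntegral.

Lemma sw_terms (K : fieldType) (A : lmodType K) (I : Type) (r l : I -> A -> A)
    (V : lmodType K) (F : A -> A -> V) (t : tensor r l) :
  sw (terms t) F =
  \sum_(x <- msupp (repr t)) F ((repr t)@_x *: x.1) x.2.
Proof. by rewrite /sw big_map. Qed.

(** * Coassociativity from threefold tensor products *)

Section Coassoc.
Context (K : fieldType) (A B C : lmodType K).
Context (mA : A -> A -> A) (mB : B -> B -> B) (mC : C -> C -> C).
Context (muB : {scalar B}) (muC : {scalar C}) (s s' o : side A B C).
Hypothesis ax : side_axioms mA mB mC muB muC s o.
Context (I J : Type) (r l : I -> A -> A) (r' l' : J -> A -> A).
Context (D : A -> A -> tensor r l) (E : A -> A -> tensor r' l').
Hypothesis dlE : forall a b, dl s a b = terms (D a b).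
Hypothesis drE : forall a b, dr s' a b = terms (E a b).
Hypothesis bal_s : forall (V : lmodType K) (F : A -> A -> V),
  bal s F -> balanced r l F.
Hypothesis bal_s' : forall (V : lmodType K) (F : A -> A -> V),
  bal s' F -> balanced r' l' F.

(** A trilinear map balanced in both pairs of neighbouring legs descends to [tensor3]; the induced
    map [g] is applied to the given identity of tensors. *)
Lemma coassoc_tensor3 :
  (forall a b c,
    tlift (fun p q => tlift (fun u v => tens3 u v q) (D p a)) (E b c) =
    tlift (fun p q => tlift (fun u v => tens3 p u v) (E q c)) (D b a)
      :> tensor3 r l r' l') ->
  coassoc s s'.
Proof.
move=> h V F b1 b2 a b c.
pose G (t : A * A * A) := F t.1.1 t.1.2 t.2.
have fB v w : free_lift G (v - w) = free_lift G v - free_lift G w.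
  by rewrite -[- w]scaleN1r [v + _]addrC free_lift_linear scaleN1r addrC.
have fZ k v : free_lift G (k *: v) = k *: free_lift G v.
  exact: (linear_scale (free_lift_linear G)).
have flE m n p : free_lift G << (m, n, p) >> = F m n p.
  exact: free_lift_gen.
have F1 k u u' v w : F (k *: u + u') v w = k *: F u v w + F u' v w.
  exact: ((b1 w).1.1 v k u u').
have F2 k u v v' w : F u (k *: v + v') w = k *: F u v w + F u v' w.
  exact: ((b1 w).1.2 u k v v').
have F3 k u v w w' : F u v (k *: w + w') = k *: F u v w + F u v w'.
  exact: ((b2 u).1.2 v k w w').
have F10 v w : F 0 v w = 0 by exact: (bilinear0l (b1 w).1).
have F20 u w : F u 0 w = 0 by exact: (bilinear0r (b1 w).1).
have F30 u v : F u v 0 = 0 by exact: (bilinear0r (b2 u).1).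
have G0 v : tensor3_rel r l r' l' v -> free_lift G v = 0.
  case=> [m m' n p|m n n' p|m n p p'|k m n p|k m n p|k m n p|i m n p|i m n p].
  - transitivity (F (m + m') n p - F m n p - F m' n p).
      by rewrite 2!fB; congr (_ - _ - _); exact: flE.
    by rewrite -[X in F (X + _)]scale1r F1 scale1r -addrA -opprD subrr.
  - transitivity (F m (n + n') p - F m n p - F m n' p).
      by rewrite 2!fB; congr (_ - _ - _); exact: flE.
    by rewrite -[X in F _ (X + _)]scale1r F2 scale1r -addrA -opprD subrr.
  - transitivity (F m n (p + p') - F m n p - F m n p').
      by rewrite 2!fB; congr (_ - _ - _); exact: flE.
    by rewrite -[X in F _ _ (X + _)]scale1r F3 scale1r -addrA -opprD subrr.
  - transitivity (F (k *: m) n p - k *: F m n p).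
      by rewrite fB fZ; congr (_ - _ *: _); exact: flE.
    by rewrite -[X in F X]addr0 F1 F10 addr0 subrr.
  - transitivity (F m (k *: n) p - k *: F m n p).
      by rewrite fB fZ; congr (_ - _ *: _); exact: flE.
    by rewrite -[X in F _ X]addr0 F2 F20 addr0 subrr.
  - transitivity (F m n (k *: p) - k *: F m n p).
      by rewrite fB fZ; congr (_ - _ *: _); exact: flE.
    by rewrite -[X in F _ _ X]addr0 F3 F30 addr0 subrr.
  - transitivity (F (r i m) n p - F m (l i n) p).
      by rewrite fB; congr (_ - _); exact: flE.
    by rewrite ((bal_s (b1 _)).2) subrr.
  - transitivity (F m (r' i n) p - F m n (l' i p)).
      by rewrite fB; congr (_ - _); exact: flE.
    by rewrite ((bal_s' (b2 _)).2) subrr.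
have [] := pres_liftP G0; move: (pres_lift G) => g lg gE.
have gsum (M N : lmodType K) (X : Type) (rr : X -> M -> M) (ll : X -> N -> N)
    (f : M -> N -> tensor3 r l r' l') (t : tensor rr ll) :
    g (tlift f t) = tlift (fun p q => g (f p q)) t.
  rewrite !tlift_sum (linear_sum_seq lg); apply: eq_bigr => x _.
  exact: (linear_scale lg).
have e := etrans (esym (gsum _ _ _ _ _ _ _))
  (etrans (congr1 g (h a b c)) (gsum _ _ _ _ _ _ _)).
transitivity (tlift (fun p q => g (tlift (fun u v => tens3 u v q) (D p a))) (E b c)).
  rewrite drE tlift_sum sw_terms; apply: eq_bigr => x _.
  (* [tlift] keeps the coefficient outside while [terms] puts it into the first factor; linearity of
     [dl] in its first argument reconciles the two. *)
  rewrite gsum (@linear_scale _ _ _ (fun p => sw (dl s p a) (fun u v => F u v x.2))).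
    rewrite dlE; congr (_ *: _).
    apply: etrans (esym (tlift_terms _ (b1 x.2).1)) _.
    by apply: eq_tlift => u v; rewrite gE.
  by move=> k p p'; rewrite (dl_linl ax (b1 _)).
rewrite e dlE [LHS]tlift_sum sw_terms; apply: eq_bigr => x _.
rewrite gsum drE (eq_tlift _ (fun u v => gE (x.1, u, v))).
rewrite (tlift_terms _ (b2 x.1).1) /sw scaler_sumr.
apply: eq_bigr => p _; by rewrite -[_ *: x.1]addr0 F1 F10 addr0.
Qed.

End Coassoc.

(** * Bijectivity of the canonical maps *)

Section CanonicalMaps.
Context (K : fieldType) (A : lmodType K).

Section Bijective.
Context (I J : Type) (r l : I -> A -> A) (r' l' : J -> A -> A).
Context (f : A -> A -> tensor r' l').
Hypothesis bf : is_bilinear f.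
Hypothesis hf : forall i m n, f (r i m) n = f m (l i n).
Hypothesis f_bij : bijective (tlift f : tensor r l -> tensor r' l').

Lemma tlift_bij_surj p q : exists t : seq (A * A), sw t f = tens p q.
Proof.
have [g _ gK] := f_bij; exists (terms (g (tens p q))).
by rewrite -[RHS]gK (tlift_terms _ bf).
Qed.

Lemma tlift_bij_inj (t : seq (A * A)) : sw t f = 0 ->
  forall (V : lmodType K) (G : A -> A -> V), balanced r l G -> sw t G = 0.
Proof.
move=> f0 V G [bG hG]; have [lf fE] := tliftP bf hf.
have t0 : sw t (fun u v => tens u v : tensor r l) = 0.
  apply: (bij_inj f_bij); rewrite (sw_linear _ _ lf) (linear_at0 lf) -[RHS]f0.
  by apply: eq_sw => u v; rewrite fE.
have [lG GE] := tliftP bG hG.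
rewrite -(linear_at0 lG) -t0 (sw_linear _ _ lG).
by apply: eq_sw => u v; rewrite GE.
Qed.

End Bijective.

Context (B C : lmodType K).
Context (mA : A -> A -> A) (mB : B -> B -> B) (mC : C -> C -> C).
Context (muB : {scalar B}) (muC : {scalar C}) (s o : side A B C).
Hypothesis ax : side_axioms mA mB mC muB muC s o.
(** [T] and [tau] are a model of the tensor square balanced as in [bal s]. *)
Context (T : lmodType K) (tau f : A -> A -> T).
Hypothesis tau_bal : bal s tau.
Hypothesis tau_univ : forall (V : lmodType K) (F : A -> A -> V), bal s F ->
  exists2 g : T -> V, linear g & forall u v, g (tau u v) = F u v.
Hypothesis dl_tau : forall u v, sw (dl s v u) tau = f u v.

(** Together with [canonical_balanced], this makes the canonical map well defined on its tensor
    product; both follow from the rules for [dl]. *)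
Lemma canonical_bilinear : is_bilinear f.
Proof.
split=> [v|u] k a b; rewrite -!dl_tau.
  exact: (dl_linr ax tau_bal).
exact: (dl_linl ax tau_bal).
Qed.

Lemma canonical_balanced y u v : f (cact s y u) v = f u (cact o y v).
Proof. by rewrite -!dl_tau (dl_cacto ax tau_bal). Qed.

Lemma canonical_surjP :
  (forall p q, exists t : seq (A * A), sw t f = tau p q) -> canonical_surj s.
Proof.
move=> h p q; have [t tE] := h p q; exists t => V F /tau_univ[g lg gE].
rewrite -gE -tE (sw_linear _ _ lg); apply: eq_sw => u v.
by rewrite -dl_tau (sw_linear _ _ lg); apply: eq_sw => u' v'; rewrite gE.
Qed.

Lemma canonical_injP :
  (forall t : seq (A * A), sw t f = 0 ->
     forall (V : lmodType K) (G : A -> A -> V),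
       balanced (cact s) (cact o) G -> sw t G = 0) ->
  canonical_inj o s.
Proof.
move=> h t ht; apply: h; rewrite -[RHS](ht T tau tau_bal).
by apply: eq_sw => u v; rewrite dl_tau.
Qed.

End CanonicalMaps.

(** * Full integrals on a regular multiplier Hopf algebroid *)

Section HopfSides.
Context (K : fieldType) (H : regular_multiplier_Hopf_algebroid K).
Notation A := (tot H).
Notation B := (bB H).
Notation C := (bC H).
Context (epsB : {linear A -> B}) (epsC : {linear A -> C}).
Context (muB : {scalar B}) (muC : {scalar C}).
Hypothesis epsBP : left_counit epsB.
Hypothesis epsCP : right_counit epsC.
Hypothesis projH : projective H.
Hypothesis mu : base_weight epsB epsC muB muC.

Let Lside := left_side epsB.
Let Rside := right_side epsC.
Let axl := left_side_axioms epsBP projH mu.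
Let axr := right_side_axioms epsCP projH mu.

Lemma hopf_sides :
  hopf_axioms (@nmul K A) (@nmul K B) (@nmul K C) muB muC Lside Rside.
Proof.
split; [exact: axl|exact: axr| | | | |].
- by move=> a; rewrite (mu_counits mu) -(muB_SC mu).
- exact: (coassoc_tensor3 (s' := Lside) axl (D := fun a b => DeltaB1l a b)
    (E := fun a b => DeltaB1r a b) (fun _ _ => erefl) (fun _ _ => erefl)
    (@bal_left K H epsB) (@bal_left K H epsB) (fun a b c => DeltaB_coassoc a b c)).
- exact: (coassoc_tensor3 (s' := Rside) axr (D := fun a b => DeltaC1l b a)
    (E := fun a b => DeltaC1r b a) (fun _ _ => erefl) (fun _ _ => erefl)
    (@bal_right K H epsC) (@bal_right K H epsC) (fun a b c => DeltaC_coassoc a b c)).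
- exact: (coassoc_tensor3 (s' := Rside) axl (D := fun a b => DeltaB1l a b)
    (E := fun a b => DeltaC1r b a) (fun _ _ => erefl) (fun _ _ => erefl)
    (@bal_left K H epsB) (@bal_right K H epsC) (fun a b c => DeltaBC_coassoc a b c)).
- exact: (coassoc_tensor3 (s' := Lside) axr (D := fun a b => DeltaC1l b a)
    (E := fun a b => DeltaB1r a b) (fun _ _ => erefl) (fun _ _ => erefl)
    (@bal_right K H epsC) (@bal_left K H epsB) (fun a b c => DeltaCB_coassoc a b c)).
Qed.

Let tauL (u v : A) : tensor_l H := tens u v.
Let tauR (u v : A) : tensor_r H := tens u v.

Let tauL_bal : bal Lside tauL.
Proof. by split; [exact: tens_bilinear|exact: tens_balanced]. Qed.

Let tauR_bal : bal Rside tauR.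
Proof.
split=> [|x u v]; first exact: tens_bilinear.
have -> : bact Rside x u = rSC (SCinv x) u by rewrite /rSC SCinvK.
exact: tens_balanced.
Qed.

Let tauL_co_bal : bal (co_side Lside) (fun u v => tauL v u).
Proof.
split=> [|y u v]; first exact/bilinear_flip/tens_bilinear.
rewrite /tauL -[bact (co_side _) y u]/(lC y u) -{1}[y](@SBinvK K H).
exact/esym/tens_balanced.
Qed.

Let tauR_co_bal : bal (co_side Rside) (fun u v => tauR v u).
Proof.
split=> [|y u v]; first exact/bilinear_flip/tens_bilinear.
exact/esym/tens_balanced.
Qed.

Let tauL_univ (V : lmodType K) (F : A -> A -> V) : bal Lside F ->
  exists2 g : tensor_l H -> V, linear g & forall u v, g (tauL u v) = F u v.
Proof. by case=> bF hF; have [lg gE] := tliftP bF hF; exists (tlift F). Qed.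

Let tauR_univ (V : lmodType K) (F : A -> A -> V) : bal Rside F ->
  exists2 g : tensor_r H -> V, linear g & forall u v, g (tauR u v) = F u v.
Proof.
by move=> /bal_right[bF hF]; have [lg gE] := tliftP bF hF; exists (tlift F).
Qed.

Lemma canonical_right : canonical_surj Rside /\ canonical_inj Lside Rside.
Proof.
have fE u v : sw (dl Rside v u) tauR = DeltaC1l u v by exact/esym/termsE.
have bf := canonical_bilinear axr tauR_bal fE.
have hf := canonical_balanced axr tauR_bal fE.
split.
- apply: (canonical_surjP tauR_univ fE) => p q.
  exact: (tlift_bij_surj bf (@lambda_T_bij K H)).
- apply: (canonical_injP tauR_bal fE) => t.
  exact: (tlift_bij_inj bf hf (@lambda_T_bij K H)).
Qed.

Lemma canonical_left : canonical_surj Lside /\ canonical_inj Rside Lside.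
Proof.
have fE u v : sw (dl Lside v u) tauL = DeltaB1l v u by exact/esym/termsE.
have bf := canonical_bilinear axl tauL_bal fE.
have hf := canonical_balanced axl tauL_bal fE.
split.
- apply: (canonical_surjP tauL_univ fE) => p q.
  exact: (tlift_bij_surj bf (@T_lambda_bij K H)).
- apply: (canonical_injP tauL_bal fE) => t.
  exact: (tlift_bij_inj bf hf (@T_lambda_bij K H)).
Qed.

Lemma flip_termsK (s : seq (A * A)) : flip_terms (flip_terms s) = s.
Proof. by rewrite /flip_terms -map_comp map_id_in // => -[]. Qed.

(** The canonical map of the exchanged side is T_rho with the legs flipped in source and target,
    which accounts for [flip_terms]. *)
Lemma canonical_co_left :
  canonical_surj (co_side Lside) /\ canonical_inj (co_side Rside) (co_side Lside).
Proof.
have axc := side_axioms_co axl.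
have fE u v : sw (dl (co_side Lside) v u) (fun u v => tauL v u) = DeltaB1r v u.
  by rewrite sw_flip; exact/esym/termsE.
have bf := bilinear_flip (canonical_bilinear axc tauL_co_bal fE).
have hf (x : B) (u v : A) : DeltaB1r (rB x u) v = DeltaB1r u (lB x v).
  exact: (esym (canonical_balanced axc tauL_co_bal fE x v u)).
split.
- apply: (canonical_surjP (tau := fun u v => tauL v u) _ fE).
    by move=> V F /(bal_co axl)/tauL_univ[g lg gE]; exists g.
  move=> p q; have [t tE] := tlift_bij_surj bf (@T_rho_bij K H) q p.
  by exists (flip_terms t); rewrite sw_flip.
- apply: (canonical_injP tauL_co_bal fE) => t t0 V G [bG hG].
  rewrite -[t]flip_termsK sw_flip.
  apply: (tlift_bij_inj bf hf (@T_rho_bij K H)); first by rewrite sw_flip.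
  by split=> [|x u v]; [exact: bilinear_flip | rewrite -hG].
Qed.

Lemma canonical_co_right :
  canonical_surj (co_side Rside) /\ canonical_inj (co_side Lside) (co_side Rside).
Proof.
have axc := side_axioms_co axr.
have fE u v : sw (dl (co_side Rside) v u) (fun u v => tauR v u) = DeltaC1r u v.
  by rewrite sw_flip; exact/esym/termsE.
have bf := bilinear_flip (canonical_bilinear axc tauR_co_bal fE).
have hf (x : B) (u v : A) : DeltaC1r v (lB x u) = DeltaC1r (rB x v) u.
  exact: (esym (canonical_balanced axc tauR_co_bal fE x v u)).
split.
- apply: (canonical_surjP (tau := fun u v => tauR v u) _ fE).
    by move=> V F /(bal_co axr)/tauR_univ[g lg gE]; exists g.
  move=> p q; have [t tE] := tlift_bij_surj bf (@rho_T_bij K H) q p.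
  by exists (flip_terms t); rewrite sw_flip.
- apply: (canonical_injP tauR_co_bal fE) => t t0 V G [bG hG].
  rewrite -[t]flip_termsK sw_flip.
  apply: (tlift_bij_inj bf hf (@rho_T_bij K H)); first by rewrite sw_flip.
  by split=> [|x u v]; [exact: bilinear_flip | rewrite -hG].
Qed.

Lemma faithfulP (w : {scalar A}) :
  (forall a, (forall b, w (b ** a) = 0) -> a = 0) /\
  (forall a, (forall b, w (a ** b) = 0) -> a = 0) -> faithful w.
Proof.
move=> [wl wr] d /eqP d0; split; apply: contrapT => h; apply: d0.
- by apply: wr => b; apply/eqP/negPn/negP => e; apply: h; exists b.
- by apply: wl => b; apply/eqP/negPn/negP => e; apply: h; exists b.
Qed.

Lemma full_left_integral_faithful (phi : {scalar A}) :
  full_left_integral muB muC phi -> faithful phi.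
Proof.
move=> [Bphi [phiB [Cphi [phiC [ad inv surjl surjr]]]]].
have [ax [sr ir] [sl il]] := And3 hopf_sides canonical_right canonical_left.
have CphiP : forall y a, phi (cact Lside y a) = muC (y ** Cphi a).
  exact: (adapted_lC ad).
apply: faithfulP; apply: (faithful_integral ax sr ir sl il (adapted_lB ad)
  (adapted_rB ad) CphiP (adapted_rC ad) _ surjl surjr) => a b.
rewrite -[RHS]inv tlift_terms //.
exact: (bal_slice (hopf_axioms_op ax) CphiP).1.
Qed.

(** For the exchanged legs a right integral is a left one: B and C change places and [Bpsi] takes
    the role of [Cphi]. *)
Lemma full_right_integral_faithful (psi : {scalar A}) :
  full_right_integral muB muC psi -> faithful psi.
Proof.
move=> [Bpsi [psiB [Cpsi [psiC [ad inv surjl surjr]]]]].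
have ax := hopf_axioms_co hopf_sides.
have [[sr ir] [sl il]] := conj canonical_co_right canonical_co_left.
have CphiP : forall y a, psi (cact (co_side Lside) y a) = muB (y ** Bpsi a).
  exact: (adapted_lB ad).
apply: faithfulP; apply: (faithful_integral ax sr ir sl il (adapted_lC ad)
  (adapted_rC ad) CphiP (adapted_rB ad) _ surjl surjr) => a b.
rewrite -[RHS]inv tlift_terms ?sw_flip //.
exact/bilinear_flip/(bal_slice (hopf_axioms_op ax) CphiP).1.
Qed.

End HopfSides.

Theorem theorem3p6p1 (R : realType)
    (H : regular_multiplier_Hopf_algebroid R[i])
    (epsB : {linear tot H -> bB H}) (epsC : {linear tot H -> bC H})
    (muB : {scalar bB H}) (muC : {scalar bC H}) :
  left_counit epsB -> right_counit epsC ->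
  projective H -> base_weight epsB epsC muB muC ->
  (forall phi : {scalar tot H},
     full_left_integral muB muC phi -> faithful phi) /\
  (forall psi : {scalar tot H},
     full_right_integral muB muC psi -> faithful psi).
Proof.
move=> epsBP epsCP projH mu; split=> w.
- exact: (full_left_integral_faithful epsBP epsCP projH mu).
- exact: (full_right_integral_faithful epsBP epsCP projH mu).
Qed.
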